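(* Let $n \ge m \ge 3$ be integers, and let $f(n,m)$ denote the maximal number of connected components of the intersection $P \cap Q$, where $P$ ranges over regions bounded by an $n$-gon and $Q$ ranges over regions bounded by an $m$-gon in the plane. Then $$\left\lfloor \frac{m}{2}\right\rfloor \cdot \left\lfloor \frac{n}{2}\right\rfloor\le f(n,m)\le \left\lfloor \frac{m}{2}\right\rfloor \cdot \frac{n}{2} + \frac{m}{2}.$$
   Context: A polygon ($k$-gon) is a piecewise linear simple closed curve in the plane with $k$ sides; the region it bounds is the bounded component of its complement (the interior). The paper takes these regions to be open; it also asserts that the maximal number of components is the same whether the regions are taken open or closed. *)

(* Defs.v *)
From HB Require Import structures.
From mathcomp Require Import all_boot all_order all_algebra.
From mathcomp Require Import all_classical all_reals all_analysis.
Set Implicit Arguments. Unset Strict Implicit. Unset Printing Implicit Defensive.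
Import Order.TTheory GRing.Theory Num.Theory.
Import numFieldNormedType.Exports.
Local Open Scope classical_set_scope.
Local Open Scope ring_scope.

Definition pt (R : realType) := 'rV[R]_2.

Definition seg (R : realType) (a b : pt R) : set (pt R) :=
  [set (1 - t) *: a + t *: b | t in `[0, 1]%classic].

Definition collinear (R : realType) (a b c : pt R) : Prop :=
  (b - a) 0 0 * (c - a) 0 1 - (b - a) 0 1 * (c - a) 0 0 = 0.

Definition side (R : realType) (k : nat) (v : 'I_k -> pt R) (i : 'I_k) :=
  seg (v i) (v (ordS i)).

(* v is (the vertex cycle of) a k-gon: a simple closed polygonal curve with
   exactly k sides (adjacent sides meet only at their common vertex,
   non-adjacent sides are disjoint, no two consecutive sides are collinear). *)
Definition is_polygon (R : realType) (k : nat) (v : 'I_k -> pt R) : Prop :=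
  [/\ (3 <= k)%N,
      (forall i, side v i `&` side v (ordS i) = [set v (ordS i)]),
      (forall i j, i != j -> j != ordS i -> i != ordS j ->
         side v i `&` side v j = set0)
    & (forall i, ~ collinear (v i) (v (ordS i)) (v (ordS (ordS i))))].

Definition curve (R : realType) (k : nat) (v : 'I_k -> pt R) : set (pt R) :=
  \bigcup_(i in [set: 'I_k]) side v i.

Definition region (R : realType) (k : nat) (v : 'I_k -> pt R) : set (pt R) :=
  [set x | ~ curve v x /\ bounded_set (connected_component (~` curve v) x)].

Definition components (R : realType) (S : set (pt R)) : set (set (pt R)) :=
  [set connected_component S x | x in S].

Definition ncomp_ge (R : realType) (S : set (pt R)) (k : nat) : Prop :=
  exists F : 'I_k -> set (pt R), injective F /\ forall i, components S (F i).

Definition fmax (R : realType) (n m : nat) : \bar R :=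
  ereal_sup [set ((k%:R : R)%:E) | k in
    [set k : nat | exists (vP : 'I_n -> pt R) (vQ : 'I_m -> pt R),
       [/\ is_polygon vP, is_polygon vQ & ncomp_ge (region vP `&` region vQ) k]]].

(* Main.v *)
Require Import Defs.
From mathcomp Require Import all_boot all_order all_algebra.
From mathcomp Require Import all_classical all_reals all_analysis.
From mathcomp Require Import ring lra.
Set Implicit Arguments. Unset Strict Implicit. Unset Printing Implicit Defensive.
Import Order.TTheory GRing.Theory Num.Theory.
Import numFieldNormedType.Exports.
Local Open Scope classical_set_scope.
Local Open Scope ring_scope.

(** Upper bound.  Let C be a component of P `&` Q and p a point of its closure
    at maximal Euclidean distance from some z.  A chord of C near p, orthogonal
    to p - z, ends on the two curves.  Either one of its ends lies on a side of
    P (which then passes through p) inside Q, so that C is adjacent to a piece of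
    (side of P) `&` Q; or both ends lie on sides of Q, and then p is a vertex of Q
    whose angular sector is filled by C.  Varying z gives at least two such
    "items" for each C, on different sides of P or at different vertices of Q.
    A component of the complement of a polygon that is unbounded touches the
    whole polygon, so P lies on at most one side of each of its edges, and each
    item belongs to one component only.  Finally a line meets Q in at most m./2
    intervals, because the ends of these intervals can be charged to distinct
    sides of Q.  Hence 2c <= n * m./2 + m, without any general position argument.

    Lower bound.  P is a zigzag with n./2 tips closed by one low vertex, Q is
    a zigzag of the same kind reflected in the diagonal; each of the n./2 spikes of P
    crosses each of the m./2 spikes of Q. *)

(** * Plane topology in coordinates *)

(** A region is known only through boundedness of components of the complement, so its geometry is
    read off from local pictures of the curve: a small box round a curve point is cut into two
    connected sectors, and the exterior component occupies one of them. The lower bound has the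
    converse task of certifying region points: a bounded open set whose closure adds only curve
    points cannot be left by a connected set off the curve.

    The farthest point p is used because circles are strictly curved: where C lies in the disc round
    z through p, a chord close to p and orthogonal to p - z is short, so that its ends are governed
    by the sides through p. The bound is asymmetric in P and Q because sides of P count through
    their pieces inside Q, whereas sides of Q count only through their common vertices. Ends of
    intervals are charged to sides transverse to the line, since such a side meets the line once and
    so determines the end. *)

Lemma ord2P (k : 'I_2) : k = 0 \/ k = 1.
Proof. by case: k => -[|[|//]] i; [left|right]; apply: val_inj. Qed.

Section Plane.
Variable R : realType.
Implicit Types (x y z a b c u v : pt R) (A B S V : set (pt R)) (e s t : R).

Lemma pt_eq x y : x 0 0 = y 0 0 -> x 0 1 = y 0 1 -> x = y.
Proof.
move=> h0 h1; apply/rowP => k; case: (ord2P k) => ->//.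
Qed.

Definition box x e : set (pt R) :=
  [set y | `|y 0 0 - x 0 0| < e /\ `|y 0 1 - x 0 1| < e].

Lemma box_refl x e : 0 < e -> box x e x.
Proof. by move=> e0; rewrite /box /= !subrr normr0. Qed.

Lemma box_le x e e' : e <= e' -> box x e `<=` box x e'.
Proof. by move=> ee y [h1 h2]; split; apply: lt_le_trans ee. Qed.

Lemma nbhs_boxP x A : nbhs x A <-> exists2 e, 0 < e & box x e `<=` A.
Proof.
split.
  move/nbhs_ballP => [e /= e0 eA]; exists e => // y [y0 y1]; apply: eA.
  rewrite /ball /= /mx_ball; split=> // i j; rewrite (ord1 i).
  by case: (ord2P j) => ->; rewrite /ball /= distrC.
move=> [e e0 eA]; apply/nbhs_ballP; exists e => //= y [_ yb]; apply: eA.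
by split; rewrite distrC; apply: yb.
Qed.

Lemma open_boxP A :
  open A <-> forall x, A x -> exists2 e, 0 < e & box x e `<=` A.
Proof.
rewrite openE; split=> h x Ax; first by apply/nbhs_boxP; apply: h.
by apply/nbhs_boxP; apply: h.
Qed.

Lemma closure_boxP A x :
  closure A x <-> forall e, 0 < e -> exists2 y, box x e y & A y.
Proof.
split=> [cA e e0|h B /nbhs_boxP[e e0 eB]].
  have [|y [Ay yb]] := cA (box x e); last by exists y.
  by apply/nbhs_boxP; exists e.
by have [y yb Ay] := h e e0; exists y; split=> //; apply: eB.
Qed.

Lemma open_box x e : open (box x e).
Proof.
apply/open_boxP => y [h0 h1].
exists (Num.min (e - `|y 0 0 - x 0 0|) (e - `|y 0 1 - x 0 1|)).
  by rewrite lt_min !subr_gt0 h0.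
move=> z []; rewrite !lt_min !ltrBrDr => /andP[p0 _] /andP[_ p1]; split.
  by apply: le_lt_trans p0; rewrite -[X in `|X|](subrKA (y 0 0)) ler_normD.
by apply: le_lt_trans p1; rewrite -[X in `|X|](subrKA (y 0 1)) ler_normD.
Qed.

Lemma segP a b x : seg a b x <-> exists t, [/\ 0 <= t, t <= 1,
  x 0 0 = (1 - t) * a 0 0 + t * b 0 0 & x 0 1 = (1 - t) * a 0 1 + t * b 0 1].
Proof.
split=> [[t /=]|[t [t0 t1 h0 h1]]].
  by rewrite in_itv/= => /andP[t0 t1 <-]; exists t; rewrite !mxE.
by exists t; rewrite /= ?in_itv/= ?t0//; apply: pt_eq; rewrite !mxE.
Qed.

Lemma segl a b : seg a b a.
Proof. by apply/segP; exists 0; split=> //; ring. Qed.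

Lemma segr a b : seg a b b.
Proof. by apply/segP; exists 1; split=> //; ring. Qed.

Lemma seg_line_continuous a b : continuous (fun t => (1 - t) *: a + t *: b).
Proof.
move=> t; apply: cvgD; apply: cvgZr_tmp; last exact: cvg_id.
by apply: cvgB; [exact: cvg_cst | exact: cvg_id].
Qed.

Lemma seg_connected a b : connected (seg a b).
Proof.
apply: connected_continuous_connected; first exact: segment_connected.
exact/continuous_subspaceT/seg_line_continuous.
Qed.

Lemma seg_compact a b : compact (seg a b).
Proof.
apply: continuous_compact; last exact: segment_compact.
exact/continuous_subspaceT/seg_line_continuous.
Qed.

Lemma seg_closed a b : closed (seg a b).
Proof. by apply: compact_closed; [exact: norm_hausdorff | exact: seg_compact]. Qed.

Lemma star_connected x A : A x -> (forall y, A y -> seg x y `<=` A) -> connected A.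
Proof.
move=> Ax h.
have -> : A = \bigcup_(y in A) seg x y.
  apply/seteqP; split=> [y Ay|y [z Az]]; last exact: h.
  by exists y => //; exact: segr.
apply: bigcup_connected; last by move=> *; exact: seg_connected.
by exists x => y _; exact: segl.
Qed.

Definition convex A := forall x y, A x -> A y -> seg x y `<=` A.

Lemma convex_connected A : convex A -> connected A.
Proof.
move=> cA; have [[x Ax]|] := pselect (A !=set0).
  by apply: (star_connected Ax) => y Ay; exact: cA.
by move=> /set0P/negP/negPn/eqP ->; exact: connected0.
Qed.

Lemma convexI A B : convex A -> convex B -> convex (A `&` B).
Proof. by move=> cA cB x y [? ?] [? ?] z zs; split; [apply: cA zs|apply: cB zs]. Qed.

Lemma convex_box x e : convex (box x e).
Proof.
move=> y z [y0 y1] [z0 z1] w /segP[t [t0 t1 h0 h1]].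
rewrite /box /= h0 h1 !ltr_norml; move: y0 y1 z0 z1; rewrite !ltr_norml.
move=> /andP[a1 a2] /andP[a3 a4] /andP[a5 a6] /andP[a7 a8].
have cvx p q r : p < q -> p < r -> p < (1 - t) * q + t * r.
  by move=> pq pr; have [q_r|r_q] := lerP q r; nra.
have cvx' p q r : q < p -> r < p -> (1 - t) * q + t * r < p.
  by move=> pq pr; have [q_r|r_q] := lerP q r; nra.
split; apply/andP; split; rewrite ?ltrBrDr ?ltrBlDr; (apply: cvx || apply: cvx'); lra.
Qed.

Lemma boundedP A : bounded_set A <->
  exists M, forall x, A x -> `|x 0 0| <= M /\ `|x 0 1| <= M.
Proof.
have nE x : `|x| = \big[Num.max/0]_ij `|x ij.1 ij.2| := mx_normrE x.
split.
  move=> [M [Mr hM]]; exists (M + 1) => x Ax.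
  have M1 : M < M + 1 by rewrite ltrDl.
  have /= := hM (M + 1) M1 x Ax; rewrite nE => h.
  by split; apply: le_trans h; apply/bigmax_geP; right;
    [exists (0, 0)|exists (0, 1)].
move=> [M hM]; exists M; split; first exact: num_real.
move=> N MN x Ax /=; have [h0 h1] := hM x Ax; rewrite nE.
apply: bigmax_le => /=; first by apply: le_trans (normr_ge0 _) (le_trans h0 (ltW MN)).
move=> [i j] _ /=; rewrite (ord1 i).
by case: (ord2P j) => ->; apply: le_trans (ltW MN).
Qed.

(** The property is asked for all smaller radii, so that the minimum of finitely many radii serves
    every index. *)
Lemma uniform_radius n (P : 'I_n -> R -> Prop) :
  (forall i, exists2 e, 0 < e & forall e', 0 < e' <= e -> P i e') ->
  exists2 e, 0 < e & forall e', 0 < e' <= e -> forall i, P i e'.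
Proof.
move=> h.
have /choice[f hf] : forall i, exists e, 0 < e /\ forall e', 0 < e' <= e -> P i e'.
  by move=> i; have [e e0 he] := h i; exists e.
exists (\big[Num.min/1]_i f i).
  by apply/bigmin_gtP; split=> // i _; case: (hf i).
move=> e' /andP[e0 /bigmin_geP[_ le]] i.
by apply: (hf i).2; rewrite e0 le.
Qed.

Lemma comp_sub S A x y : connected A -> A `<=` S -> A y ->
  connected_component S x y -> A `<=` connected_component S x.
Proof.
move=> cA AS Ay /same_connected_component ->.
exact: connected_component_max.
Qed.

Lemma comp_open S x : open S -> open (connected_component S x).
Proof.
move=> /open_boxP oS; apply/open_boxP => y Cy.
have [e e0 eS] := oS y (connected_component_sub Cy).
exists e => //; apply: (comp_sub _ eS (box_refl _ e0) Cy).
exact/convex_connected/convex_box.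
Qed.

Lemma comp_closure S x : open S ->
  closure (connected_component S x) `&` S `<=` connected_component S x.
Proof.
move=> /open_boxP oS y [/closure_boxP cy Sy].
have [e e0 eS] := oS y Sy; have [z zb Cz] := cy e e0.
apply: (comp_sub _ eS zb Cz); last exact: box_refl.
exact/convex_connected/convex_box.
Qed.

Lemma comp_eq S x y z : connected_component S x z -> connected_component S y z ->
  connected_component S x = connected_component S y.
Proof. by move=> /same_connected_component -> /same_connected_component ->. Qed.

(** Continuation along a segment: by connectedness, a closed condition that is relatively open on
    the segment cannot fail half-way. It carries contact with a component along a side. *)
Lemma seg_propagate A a b : closed A ->
  (forall x, seg a b x -> A x ->
     exists2 e, 0 < e & box x e `&` seg a b `<=` A) ->
  A a -> A b.
Proof.
move=> clA opA Aa.
suff h : seg a b `&` A = seg a b by have := segr a b; rewrite -h => -[].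
apply: seg_connected; first by exists a; split=> //; exact: segl.
  exists (\bigcup_(x in seg a b `&` A) \bigcup_(e in [set e | 0 < e /\ box x e `&` seg a b `<=` A]) box x e).
    by apply: bigcup_open => x _; apply: bigcup_open => e _; exact: open_box.
  apply/seteqP; split=> y [sy]; last by move=> [x _ [e [e0 h] ye]]; split=> //; apply: h.
  move=> Ay; split=> //; exists y => //.
  by have [e e0 h] := opA y sy Ay; exists e => //; exact: box_refl.
by exists A.
Qed.

End Plane.

(** * Regions and their curves *)

Section Region.
Variables (R : realType).
Implicit Types (x y z a b c u w : pt R) (A B S V : set (pt R)) (e s t : R).

Definition cross u w : R := u 0 0 * w 0 1 - u 0 1 * w 0 0.
Definition dot u w : R := u 0 0 * w 0 0 + u 0 1 * w 0 1.

(** Continuity of a linear form at the origin; it keeps affine coordinates within their range in a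
    small box. *)
Lemma lin_small (p q eta : R) : 0 < eta ->
  exists2 e, 0 < e & forall r s, `|r| < e -> `|s| < e -> `|p * r + q * s| < eta.
Proof.
move=> eta0; have h : 0 < `|p| + `|q| + 1 by rewrite ltr_wpDl ?addr_ge0.
exists (eta / (`|p| + `|q| + 1)); first exact: divr_gt0.
move=> r s; rewrite !ltr_pdivlMr// => hr hs.
have := ler_normD (p * r) (q * s); rewrite !normrM => hn.
have := normr_ge0 p; have := normr_ge0 q.
have := normr_ge0 r; have := normr_ge0 s; move: hr hs hn.
set P := `|p|; set Q := `|q|; set X := `|r|; set Y := `|s|.
move=> hr hs hn s0 r0 q0 p0.
apply: le_lt_trans hn _; have [XY|YX] := lerP X Y; nra.
Qed.

Lemma step_box y e u : 0 < e ->
  exists2 s, 0 < s & forall s', 0 < s' <= s -> box y e (y + s' *: u).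
Proof.
move=> e0; have h0 : 0 < `|u 0 0| + `|u 0 1| + 1 by rewrite ltr_wpDl ?addr_ge0.
exists (e / (`|u 0 0| + `|u 0 1| + 1)); first exact: divr_gt0.
move=> s /andP[s0]; rewrite ler_pdivlMr// => hs.
have := normr_ge0 (u 0 0); have := normr_ge0 (u 0 1) => h1 h2.
rewrite /box /= !mxE ![_ + s * _]addrC !addrK !normrM (gtr0_norm s0).
by split; nra.
Qed.

Lemma seg_bounded a b : exists M, forall x, seg a b x -> `|x 0 0| <= M /\ `|x 0 1| <= M.
Proof. exact/boundedP/compact_bounded/seg_compact. Qed.

Section OneCurve.
Variables (k : nat) (v : 'I_k -> pt R).

Lemma curve_closed : closed (curve v).
Proof.
by apply: closed_bigcup; [exact: finite_finset | move=> i _; exact: seg_closed].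
Qed.

Lemma curveC_open : open (~` curve v).
Proof. exact/closed_openC/curve_closed. Qed.

Lemma curve_bounded : exists2 M, 0 < M &
  forall x, curve v x -> `|x 0 0| <= M /\ `|x 0 1| <= M.
Proof.
have /choice[f hf] i := seg_bounded (v i) (v (ordS i)).
exists (\big[Num.max/1]_i f i); first by apply/bigmax_gtP; left.
move=> x [i _ sx]; have [h0 h1] := hf i x sx.
by split; [apply: le_trans h0 _|apply: le_trans h1 _]; exact: le_bigmax.
Qed.

Lemma region_comp x y : region v x ->
  connected_component (~` curve v) x y -> region v y.
Proof.
move=> [_ bx] cxy; split; first exact: (connected_component_sub cxy).
by rewrite -(same_connected_component cxy).
Qed.

Lemma region_sub A y : connected A -> A `<=` ~` curve v -> A y -> region v y ->
  A `<=` region v.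
Proof.
move=> cA Ac Ay ry z Az; apply: (region_comp ry).
exact: (connected_component_max Ay Ac cA).
Qed.

Lemma region_open : open (region v).
Proof.
apply/open_boxP => x rx.
have /open_boxP/(_ x)[|e e0 he] := @comp_open _ _ x curveC_open.
  by apply: connected_component_refl; case: rx.
by exists e => // y /he; exact: region_comp.
Qed.

Lemma region_closure : closure (region v) `<=` region v `|` curve v.
Proof.
move=> x cx; have [?|ncx] := pselect (curve v x); [by right|left].
have /open_boxP/(_ x ncx)[e e0 he] := curveC_open.
have [y yb ry] := (closure_boxP _ _).1 cx e e0.
by apply: (region_sub _ he yb ry); [exact/convex_connected/convex_box|exact: box_refl].
Qed.

(* A far point is joined to infinity by a ray pointing away from the origin. *)
Lemma far_unbounded : exists2 M, 0 < M & forall x,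
  M < `|x 0 0| \/ M < `|x 0 1| ->
  ~ curve v x /\ ~ bounded_set (connected_component (~` curve v) x).
Proof.
have [M M0 hM] := curve_bounded; exists M => // x hx.
have ncs s : 1 <= s -> ~ curve v (s *: x).
  move=> s1 /hM; rewrite !mxE !normrM ger0_norm; last lra.
  by case: hx => hx [h0 h1]; nra.
split; first by rewrite -[x]scale1r; exact: ncs.
set ray := [set s *: x | s in [set s | 1 <= s]].
have sub : ray `<=` connected_component (~` curve v) x.
  apply: (@connected_component_max _ _ _ x).
  - by exists 1; rewrite /= ?scale1r.
  - by move=> _ [s s1 <-]; exact: ncs.
  apply: (@star_connected _ x); first by exists 1; rewrite /= ?scale1r.
  move=> _ [s /= s1 <-] y /segP[t [t0 t1]]; rewrite !mxE => y0 y1.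
  exists ((1 - t) + t * s) => /=; first by nra.
  by apply: pt_eq; rewrite !mxE ?y0 ?y1; ring.
move=> /boundedP[K hK].
have K0 : 0 <= K.
  have [|h _] := hK x; last exact: le_trans h.
  by apply: sub; exists 1; rewrite /= ?scale1r.
(* The coordinate of [x] that exceeds [M] is stretched by [r + 1] to more than [K]. *)
set r := K / M; have r0 : 0 <= r by rewrite divr_ge0// ltW.
have Kr : K = r * M by rewrite /r mulfVK// gt_eqF.
have : ray ((r + 1) *: x) by exists (r + 1) => //=; rewrite lerDr.
move=> /sub /hK; rewrite !mxE !normrM ger0_norm ?addr_ge0// Kr => -[h0 h1].
by case: hx => hx; nra.
Qed.

Lemma region_bounded : exists2 M, 0 < M &
  forall x, region v x -> `|x 0 0| <= M /\ `|x 0 1| <= M.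
Proof.
have [M M0 hM] := far_unbounded; exists M => // x rx.
by split; rewrite leNgt; apply/negP => h; case: (hM x) => [|_];
  [left| case: rx |right|case: rx].
Qed.

(** Local two-sidedness at [x]. The last clause, that each sector accumulates at every curve point
    of [V], is what lets contact travel along the curve. *)
Definition sectors x V S1 S2 :=
  [/\ open V /\ V x, V `&` ~` curve v = S1 `|` S2, connected S1, connected S2 &
      V `&` curve v `<=` closure S1 `&` closure S2].

Lemma near_sides x : exists2 e, 0 < e &
  forall y j, box x e y -> side v j y -> side v j x.
Proof.
have [|e e0 he] := @uniform_radius R k (fun j e => forall y, box x e y -> side v j y -> side v j x).
  move=> j; have [sx|nsx] := pselect (side v j x); first by exists 1.
  have /open_boxP/(_ x nsx)[e e0 he] := closed_openC (@seg_closed R (v j) (v (ordS j))).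
  exists e => // e' /andP[_ ee] y /(box_le ee) /he h sy; case: (h sy).
by exists e => // y j yb; apply: (he e); rewrite ?e0 ?lexx.
Qed.

Hypothesis pv : is_polygon v.

Lemma polygon_cross i : cross (v i - v (ordS i)) (v (ordS (ordS i)) - v (ordS i)) != 0.
Proof.
case: pv => _ _ _ /(_ i) nc; apply/eqP => h; apply: nc; rewrite /collinear.
by move: h; rewrite /cross !mxE => h; lra.
Qed.

Lemma polygon_neq i : v i <> v (ordS i).
Proof.
move=> h; have := polygon_cross i; rewrite h /cross !mxE.
by rewrite !subrr !mul0r subrr eqxx.
Qed.

Lemma side_inner i j x : side v i x -> x <> v i -> x <> v (ordS i) ->
  side v j x -> j = i.
Proof.
case: pv => _ adj dis _ sx xi xi' sj; apply/eqP/negPn/negP => ji.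
have [ej|nj] := eqVneq j (ordS i).
  by apply: xi'; have : (side v i `&` side v (ordS i)) x; [rewrite -ej|rewrite adj].
have [ei|ni] := eqVneq i (ordS j).
  by apply: xi; have : (side v j `&` side v (ordS j)) x; [rewrite -ei|rewrite adj -ei].
by have : (side v i `&` side v j) x by []; rewrite dis// eq_sym.
Qed.

Lemma side_vertex i j : side v j (v (ordS i)) -> j = i \/ j = ordS i.
Proof.
case: pv => _ adj dis _ sj; set x := v _ in sj.
have si : side v i x by exact: segr.
have si' : side v (ordS i) x by exact: segl.
have [->|ji] := eqVneq j i; first by left.
have [->|ji'] := eqVneq j (ordS i); [by right|exfalso].
(* The side preceding [i] meets side [i] only in [v i], which differs from [v (ordS i)]. *)
have [ei|ni] := eqVneq i (ordS j); last first.
  by have : (side v i `&` side v j) x by []; rewrite dis// eq_sym.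
have : (side v j `&` side v (ordS j)) x by rewrite -ei.
by rewrite adj -ei => /esym; exact: polygon_neq.
Qed.

End OneCurve.
End Region.

(** * The two sides of a polygon *)

Section Sectors.
Variables (R : realType).
Implicit Types (x y z a b c d u w : pt R) (A B S V : set (pt R)) (e s t : R).

Definition affine (f : pt R -> R) :=
  forall x y t, f ((1 - t) *: x + t *: y) = (1 - t) * f x + t * f y.

Lemma convex_pos f : affine f -> convex [set y | 0 < f y].
Proof.
move=> af x y /= fx fy z [t /=]; rewrite in_itv/= => /andP[t0 t1] <-; rewrite af.
by have [h|h] := lerP (f x) (f y); nra.
Qed.

Lemma convex_neg f : affine f -> convex [set y | f y < 0].
Proof.
move=> af x y /= fx fy z [t /=]; rewrite in_itv/= => /andP[t0 t1] <-; rewrite af.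
by have [h|h] := lerP (f x) (f y); nra.
Qed.

Lemma affine_cross a d D : affine (fun y => cross (y - a) d / D).
Proof. by move=> x y t; rewrite /cross !mxE; ring. Qed.

Lemma seg_param a b x : seg a b x <->
  exists t, [/\ 0 <= t, t <= 1 & x = a + t *: (b - a)].
Proof.
split=> [/segP[t [t0 t1 h0 h1]]|[t [t0 t1 ->]]].
  by exists t; split=> //; apply: pt_eq; rewrite !mxE ?h0 ?h1; ring.
by apply/segP; exists t; split=> //; rewrite !mxE; ring.
Qed.

Lemma dot_gt0 a b : a <> b -> 0 < dot (b - a) (b - a).
Proof.
move=> ab; rewrite /dot !mxE.
have sq (p q : R) : p != q -> 0 < (p - q) ^+ 2 by rewrite exprn_even_gt0//= subr_eq0.
have p0 := sqr_ge0 (b 0 0 - a 0 0); have p1 := sqr_ge0 (b 0 1 - a 0 1).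
have [h0|/sq h0] := eqVneq (b 0 0) (a 0 0); last by nra.
have [h1|/sq h1] := eqVneq (b 0 1) (a 0 1); last by nra.
by case: ab; exact: pt_eq.
Qed.

(** The parameter is that of the orthogonal projection: [D *: (y - a)] differs from
    [dot (y - a) (b - a) *: (b - a)] by the cross product times a normal vector. *)
Lemma cross_eq0_param a b y : a <> b -> cross (y - a) (b - a) = 0 ->
  y = a + (dot (y - a) (b - a) / dot (b - a) (b - a)) *: (b - a).
Proof.
move=> /dot_gt0; set D := dot (b - a) _ => D0 c0.
have -> : dot (y - a) (b - a) / D *: (b - a) = D^-1 *: (dot (y - a) (b - a) *: (b - a)).
  by rewrite scalerA mulrC.
have -> : dot (y - a) (b - a) *: (b - a) = D *: (y - a).
  apply: pt_eq.
    transitivity (D * (y - a) 0 0 - (b - a) 0 1 * cross (y - a) (b - a)).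
      by rewrite /D /dot /cross !mxE; ring.
    by rewrite c0 mulr0 subr0 [RHS]mxE.
  transitivity (D * (y - a) 0 1 + (b - a) 0 0 * cross (y - a) (b - a)).
    by rewrite /D /dot /cross !mxE; ring.
  by rewrite c0 mulr0 addr0 [RHS]mxE.
by rewrite scalerA mulVf ?gt_eqF// scale1r addrC subrK.
Qed.

Lemma closure_step A y u (s0 : R) : 0 < s0 ->
  (forall s, 0 < s <= s0 -> A (y + s *: u)) -> closure A y.
Proof.
move=> s00 h; apply/closure_boxP => e e0.
have [s1 s10 hs] := step_box y u e0; exists (y + Num.min s0 s1 *: u).
  by apply: hs; rewrite lt_min s00 s10/= ge_min lexx orbT.
by apply: h; rewrite lt_min s00 s10/= ge_min lexx.
Qed.

Lemma closure_step_box A x e y u : box x e y ->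
  (forall s, 0 < s -> A (y + s *: u)) -> closure (box x e `&` A) y.
Proof.
move=> /((open_boxP _).1 (@open_box R x e))[e1 e10 he] h.
have [s s0 hs] := step_box y u e10; apply: (closure_step s0) => r /[dup] /andP[r0 _].
by move=> /hs /he yb; split; [exact: yb|exact: h].
Qed.

Variables (k : nat) (v : 'I_k -> pt R).
Hypothesis pv : is_polygon v.

Lemma side_sectors i x : side v i x -> x <> v i -> x <> v (ordS i) ->
  exists2 e0, 0 < e0 & forall e, 0 < e <= e0 ->
  sectors v x (box x e)
    (box x e `&` [set y | 0 < cross (y - v i) (v (ordS i) - v i)])
    (box x e `&` [set y | cross (y - v i) (v (ordS i) - v i) < 0]).
Proof.
move=> sx xa xb; have ab := polygon_neq pv (i := i).
have sx' := sx; move: sx'; rewrite /side; set a := v i in xa ab *; set b := v _ in xb ab *.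
move=> /seg_param[t0 [t00 t01 xE]].
have {}t00 : 0 < t0.
  by rewrite lt_neqAle t00 andbT; apply/eqP => h; apply: xa; rewrite xE -h scale0r addr0.
have {}t01 : t0 < 1.
  by rewrite lt_neqAle t01 andbT; apply/eqP => h; apply: xb; rewrite xE h scale1r addrC subrK.
have D0 := dot_gt0 ab; set D := dot _ _ in D0.
have [e1 e10 he1] := near_sides v x.
(* This close to [t0] the projection parameter stays in [0, 1], so inside the box the side coincides
   with its line. *)
have eta0 : 0 < Num.min t0 (1 - t0) by rewrite lt_min t00 subr_gt0.
have [e2 e20 he2] := lin_small ((b - a) 0 0 / D) ((b - a) 0 1 / D) eta0.
exists (Num.min e1 e2); first by rewrite lt_min e10.
move=> e /andP[e0]; rewrite le_min => /andP[ee1 ee2].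
have curveE y : box x e y -> curve v y <-> cross (y - a) (b - a) = 0.
  move=> yb; split=> [[j _ sj]|c0].
    have ji := side_inner pv sx xa xb (he1 y j (box_le ee1 yb) sj).
    move: sj; rewrite ji /side -/a -/b => /seg_param[t [_ _ ->]].
    by rewrite /cross !mxE; ring.
  exists i => //; apply/seg_param; rewrite -/a -/b.
  exists (dot (y - a) (b - a) / D); rewrite -cross_eq0_param//.
  have [y0 y1] := box_le ee2 yb.
  have := he2 _ _ y0 y1.
  have -> : (b - a) 0 0 / D * (y 0 0 - x 0 0) + (b - a) 0 1 / D * (y 0 1 - x 0 1)
     = dot (y - a) (b - a) / D - t0.
    have -> : t0 = dot (x - a) (b - a) / D.
      rewrite xE; apply: (@mulIf _ D); first by rewrite gt_eqF.
      by rewrite mulfVK ?gt_eqF// /D /dot !mxE; ring.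
    by rewrite /dot !mxE; ring.
  by rewrite lt_min !ltr_norml => /andP[/andP[h1 h2] /andP[h3 h4]]; split=> //; lra.
have aff : affine (fun y => cross (y - a) (b - a)).
  by move=> y z t; rewrite /cross !mxE; ring.
split.
- by split; [exact: open_box | exact: box_refl].
- apply/seteqP; split=> y.
    move=> [yb ncy].
    by have [h|h|h] := ltgtP 0 (cross (y - a) (b - a));
      [left|right|case: ncy; apply/(curveE y yb)].
  by move=> [[yb /= h]|[yb /= h]]; split=> // /(curveE y yb) h'; move: h; rewrite h' ltxx.
- by apply: convex_connected; apply: convexI; [exact: convex_box|exact: convex_pos].
- by apply: convex_connected; apply: convexI; [exact: convex_box|exact: convex_neg].
- move=> y [yb /(curveE y yb) c0].
  (* A normal whose cross product with [b - a] is [D]; steps along [n] and [- n] enter the two half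
     boxes. *)
  pose n : pt R := \row_k if k == 0 then (b - a) 0 1 else - (b - a) 0 0.
  have cn s : cross (y + s *: n - a) (b - a) = s * D.
    rewrite -[RHS]addr0 -c0 /D /n /dot /cross !mxE /=; ring.
  split; [apply: (closure_step_box (u := n)) => // s s0 /=
         |apply: (closure_step_box (u := - n)) => // s s0 /=].
    by rewrite cn mulr_gt0.
  by rewrite scalerN -scaleNr cn mulNr oppr_lt0 mulr_gt0.
Qed.

Lemma vertex_sectors i : let x := v (ordS i) in
  exists2 e0, 0 < e0 & forall e, 0 < e <= e0 ->
  exists S1 S2, sectors v x (box x e) S1 S2.
Proof.
set x := v (ordS i) => /=; have := polygon_cross pv i.
set a := v i; set c := v (ordS (ordS i)); rewrite -/x; set D := cross _ _ => D0.
have [e1 e10 he1] := near_sides v x.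
(* Coordinates in the basis [a - x], [c - x]: near [x] the curve is the boundary of the quadrant
   where both are nonnegative. *)
pose al y := cross (y - x) (c - x) / D.
pose be y := cross (y - x) (x - a) / D.
have yE y : y = x + (al y *: (a - x) + be y *: (c - x)).
  apply: pt_eq; rewrite /al /be; move: D0; rewrite /D /cross !mxE => D0; by field.
have alE p q : al (x + (p *: (a - x) + q *: (c - x))) = p.
  by rewrite /al; move: D0; rewrite /D /cross !mxE => D0; field.
have beE p q : be (x + (p *: (a - x) + q *: (c - x))) = q.
  by rewrite /be; move: D0; rewrite /D /cross !mxE => D0; field.
have [e2 e20 he2] := lin_small ((c - x) 0 1 / D) (- (c - x) 0 0 / D) ltr01.
have [e3 e30 he3] := lin_small ((x - a) 0 1 / D) (- (x - a) 0 0 / D) ltr01.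
exists (Num.min e1 (Num.min e2 e3)); first by rewrite !lt_min e10 e20.
move=> e /andP[e0]; rewrite !le_min => /andP[ee1 /andP[ee2 ee3]].
have al1 y : box x e y -> al y <= 1.
  move=> /(box_le ee2)[y0 y1]; have := he2 _ _ y0 y1; rewrite ltr_norml => /andP[_ h].
  by apply: ltW; apply: le_lt_trans h; rewrite /al /cross !mxE; lra.
have be1 y : box x e y -> be y <= 1.
  move=> /(box_le ee3)[y0 y1]; have := he3 _ _ y0 y1; rewrite ltr_norml => /andP[_ h].
  by apply: ltW; apply: le_lt_trans h; rewrite /be /cross !mxE; lra.
have curveE y : box x e y -> curve v y <-> (0 <= al y /\ be y = 0) \/ (al y = 0 /\ 0 <= be y).
  move=> yb; split=> [[j _ sj]|].
    have sjx := he1 y j (box_le ee1 yb) sj.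
    have [ji|ji] := side_vertex pv sjx; move: sj; rewrite ji => /seg_param[t [t0 t1]].
      rewrite -/a -/x => ->; left.
      have -> : a + t *: (x - a) = x + ((1 - t) *: (a - x) + 0 *: (c - x)).
        by apply: pt_eq; rewrite !mxE; ring.
      by rewrite alE beE subr_ge0.
    rewrite -/x -/c => ->; right.
    have -> : x + t *: (c - x) = x + (0 *: (a - x) + t *: (c - x)).
      by apply: pt_eq; rewrite !mxE; ring.
    by rewrite alE beE.
  move=> [[a0 b0]|[a0 b0]].
    exists i => //; apply/seg_param; exists (1 - al y).
    rewrite subr_ge0 al1// -/a -/x; split=> //; first lra.
    by rewrite {1}(yE y) b0; apply: pt_eq; rewrite !mxE; ring.
  exists (ordS i) => //; apply/seg_param; exists (be y); rewrite be1// -/x -/c; split=> //.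
  by rewrite {1}(yE y) a0; apply: pt_eq; rewrite !mxE; ring.
have afa : affine al by exact: affine_cross.
have afb : affine be by exact: affine_cross.
have stepE y s p q : y + s *: (p *: (a - x) + q *: (c - x)) =
   x + ((al y + s * p) *: (a - x) + (be y + s * q) *: (c - x)).
  by rewrite {1}(yE y); apply: pt_eq; rewrite !mxE; ring.
(* The open quadrant is convex; the other sector is a union of two half boxes, which share a point
   in the direction opposite to both sides. *)
exists (box x e `&` ([set y | 0 < al y] `&` [set y | 0 < be y])).
exists ((box x e `&` [set y | al y < 0]) `|` (box x e `&` [set y | be y < 0])).
split.
- by split; [exact: open_box | exact: box_refl].
- apply/seteqP; split=> y.
    move=> [yb ncy]; have [h|h|h] := ltgtP 0 (al y).
    + have [h'|h'|h'] := ltgtP 0 (be y); [by left|by right; right|].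
      by case: ncy; apply/(curveE y yb); left; split=> //; exact: ltW.
    + by right; left.
    + have [h'|h'|h'] := ltgtP 0 (be y); [|by right; right|].
      * by case: ncy; apply/(curveE y yb); right; split=> //; exact: ltW.
      * by case: ncy; apply/(curveE y yb); left; rewrite -h -h'.
  by move=> [[yb /= [h h']]|[[yb /= h]|[yb /= h]]]; split=> // /(curveE y yb); lra.
- apply: convex_connected; apply: convexI; first exact: convex_box.
  by apply: convexI; exact: convex_pos.
- apply: connectedU.
  + have [s s0 hs] := step_box x (- 1 *: (a - x) + - 1 *: (c - x)) e0.
    exists (x + s *: (- 1 *: (a - x) + - 1 *: (c - x))).
    have bx : box x e (x + s *: (- 1 *: (a - x) + - 1 *: (c - x))).
      by apply: hs; rewrite s0 lexx.
    have alx : al x = 0 by rewrite /al /cross !mxE !subrr; lra.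
    have bex : be x = 0 by rewrite /be /cross !mxE !subrr; lra.
    by split; split=> //=; rewrite stepE ?alE ?beE ?alx ?bex; lra.
  + by apply: convex_connected; apply: convexI; [exact: convex_box|exact: convex_neg].
  + by apply: convex_connected; apply: convexI; [exact: convex_box|exact: convex_neg].
- move=> y [yb /(curveE y yb) c0]; split.
    apply: (closure_step_box (u := 1 *: (a - x) + 1 *: (c - x))) => // s s0 /=.
    by rewrite stepE alE beE; lra.
  rewrite -setIUr; case: c0 => -[h h'].
    apply: (closure_step_box (u := 0 *: (a - x) + -1 *: (c - x))) => // s s0 /=.
    by rewrite stepE alE beE; lra.
  apply: (closure_step_box (u := -1 *: (a - x) + 0 *: (c - x))) => // s s0 /=.
  by rewrite stepE alE beE; lra.
Qed.

Lemma ordS_surj (i : 'I_k) : exists j, i = ordS j.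
Proof. by exists (ord_pred i); rewrite ord_predK. Qed.

Lemma sectors_ex x e : curve v x -> 0 < e ->
  exists V S1 S2, V `<=` box x e /\ sectors v x V S1 S2.
Proof.
move=> [i _ sx] e0.
wlog [j ->{sx}] : i sx / exists j, x = v (ordS j).
  move=> h; have [xi|xi] := pselect (x = v i).
    by apply: (h i sx); have [j ij] := ordS_surj i; exists j; rewrite xi -ij.
  have [xi'|xi'] := pselect (x = v (ordS i)); first by apply: (h i sx); exists i.
  have [e1 e10 he] := side_sectors sx xi xi'.
  exists (box x (Num.min e e1)); do 2 eexists; split; last first.
    by apply: he; rewrite lt_min e0 e10 ge_min lexx orbT.
  by apply: box_le; rewrite ge_min lexx.
have [e1 e10 he] := vertex_sectors j.
have [|S1 [S2 h]] := he (Num.min e e1).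
  by rewrite lt_min e0 e10 ge_min lexx orbT.
by do 3 eexists; split; last exact: h; apply: box_le; rewrite ge_min lexx.
Qed.

End Sectors.

(** * One-sidedness: near a curve point the region meets only one sector *)

Section OneSided.
Variables (R : realType).
Implicit Types (x y z a b c d u : pt R) (A B S V O : set (pt R)) (e s t : R).

Lemma convex_seg a b : convex (seg a b).
Proof.
move=> x y /segP[p [p0 p1 x0 x1]] /segP[q [q0 q1 y0 y1]] z /segP[t [t0 t1 z0 z1]].
apply/segP; exists ((1 - t) * p + t * q); split; [by nra|by nra|..].
  by rewrite z0 x0 y0; ring.
by rewrite z1 x1 y1; ring.
Qed.

Lemma ordS_ind k (P : 'I_k -> Prop) i :
  P i -> (forall j, P j -> P (ordS j)) -> forall j, P j.
Proof.
move=> Pi PS j.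
have it n : val (iter n (@ordS k) i) = ((i + n) %% k)%N.
  elim: n => [|n IH] /=; first by rewrite addn0 modn_small.
  by rewrite IH -addn1 modnDml addn1 addnS.
have -> : j = iter (k - i + j)%N (@ordS k) i.
  apply: val_inj; rewrite it addnA subnKC ?modnDl ?modn_small//.
  exact: ltnW.
by elim: (_ + _)%N => //= n; exact: PS.
Qed.

Variables (k : nat) (v : 'I_k -> pt R).
Hypothesis pv : is_polygon v.

(** A component point close to [x] lies in a sector; the sector is connected, hence contained in the
    component, and it accumulates on all of the curve in [V]. [O] is the plane for the exterior, and
    the other region when components of the intersection are compared. *)
Lemma touch_local O x z : open O -> curve v x -> O x ->
  closure (connected_component (~` curve v `&` O) z) x ->
  exists2 e, 0 < e &
    box x e `&` curve v `<=` closure (connected_component (~` curve v `&` O) z).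
Proof.
move=> oO cx Ox clx; have [e0 e00 he0] := (open_boxP _).1 oO x Ox.
have [V [S1 [S2 [Vb [[oV Vx] VE c1 c2 cl]]]]] := sectors_ex pv cx e00.
have [e e0' he] := (open_boxP _).1 oV x Vx.
exists e => // y [yb cy]; have [cl1 cl2] := cl y (conj (he y yb) cy).
have [q qb Uq] := (closure_boxP _ _).1 clx e e0'.
have sub S : S `<=` V `&` ~` curve v -> S `<=` ~` curve v `&` O.
  by move=> h r /h[Vr nr]; split=> //; apply/he0/Vb.
have S1V : S1 `<=` V `&` ~` curve v by rewrite VE; exact: subsetUl.
have S2V : S2 `<=` V `&` ~` curve v by rewrite VE; exact: subsetUr.
have : (V `&` ~` curve v) q by split; [exact: he|case: (connected_component_sub Uq)].
rewrite VE => -[S1q|S2q].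
  exact: (closureS (comp_sub c1 (sub _ S1V) S1q Uq)).
exact: (closureS (comp_sub c2 (sub _ S2V) S2q Uq)).
Qed.

(* The closure of an unbounded component of the complement meets the curve, and
   by [touch_local] it then spreads along the curve through all vertices. *)
Lemma exterior_touch : exists z,
  ~ bounded_set (connected_component (~` curve v) z) /\
  curve v `<=` closure (connected_component (~` curve v) z).
Proof.
have [M M0 hM] := far_unbounded v.
pose z : pt R := const_mx (M + 1).
have [ncz ubz] : ~ curve v z /\ ~ bounded_set (connected_component (~` curve v) z).
  by apply: hM; left; rewrite mxE ger0_norm; lra.
exists z; split=> //; set U := connected_component _ z in ubz *.
have UE : U = connected_component (~` curve v `&` setT) z by rewrite setIT.
have loc x : curve v x -> closure U x ->
    exists2 e, 0 < e & box x e `&` curve v `<=` closure U.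
  by rewrite UE => cx; exact: (touch_local openT cx I).
have Uz : U z by exact: connected_component_refl.
have oU : open U by exact/comp_open/curveC_open.
have spread i x y : side v i x -> side v i y -> closure U x -> closure U y.
  move=> sx sy; apply: seg_propagate; first exact: closed_closure.
  move=> q sq /loc[|e e0 he]; first by exists i => //; exact: (convex_seg sx sy).
  exists e => // r [rb sr]; apply: he; split=> //; exists i => //.
  exact: (convex_seg sx sy).
(* Otherwise the closure of [U] would continue along the segment from [z] to a vertex, a curve point
   after all. *)
have [x cx tx] : exists2 x, curve v x & closure U x.
  apply: contrapT => h; have k0 : (0 < k)%N by case: pv => /(leq_trans _) ->.
  pose i0 := Ordinal k0.
  have c0 : curve v (v i0) by exists i0 => //; exact: segl.
  apply: (h); exists (v i0) => //; apply: (@seg_propagate _ (closure U) z).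
  - exact: closed_closure.
  - move=> x _ tx; have [cx|ncx] := pselect (curve v x).
      by case: h; exists x.
    have /((open_boxP _).1 oU)[e e0 he] : U x by rewrite /U; apply: (comp_closure (@curveC_open _ _ v)); split.
    by exists e => // y [/he Uy _]; exact: subset_closure.
  - exact: subset_closure.
have [i _ six] := cx.
have tv : forall j, closure U (v j).
  apply: (ordS_ind (i := i)); first by apply: spread six _ tx; exact: segl.
  by move=> j; apply: spread; [exact: segl|exact: segr].
by move=> y [j _ sjy]; apply: (spread j (v j)) => //; exact: segl.
Qed.

(** The exterior component touches [x], so it meets a sector and, as the sector is connected,
    contains it; no region point is left there. *)
Lemma sectors_region x V S1 S2 : curve v x -> sectors v x V S1 S2 ->
  S1 `&` region v = set0 \/ S2 `&` region v = set0.
Proof.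
move=> cx [[oV Vx] VE c1 c2 _]; have [z [ub cl]] := exterior_touch.
have [e e0 he] := (open_boxP _).1 oV x Vx.
have [y yb Uy] := (closure_boxP _ _).1 (cl x cx) e e0.
have S1V : S1 `<=` ~` curve v.
  by move=> r r1; have [] : (V `&` ~` curve v) r by rewrite VE; left.
have S2V : S2 `<=` ~` curve v.
  by move=> r r1; have [] : (V `&` ~` curve v) r by rewrite VE; right.
have disj S : S `<=` connected_component (~` curve v) z -> S `&` region v = set0.
  move=> SU; apply/eqP/negPn/negP => /set0P[r [/SU Ur [_]]].
  by rewrite -(same_connected_component Ur).
have : (V `&` ~` curve v) y by split; [exact: he|exact: (connected_component_sub Uy)].
rewrite VE => -[Sy|Sy]; [left|right]; apply: disj; exact: (comp_sub _ _ Sy Uy).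
Qed.

(** The form that merges components: region points close to the same curve point are joined within
    the connected set [S]. *)
Lemma one_sided x e : curve v x -> 0 < e -> exists V S,
  [/\ open V /\ V x, V `<=` box x e, connected S /\ S `<=` V `&` ~` curve v,
      V `&` region v `<=` S & V `&` curve v `<=` closure S].
Proof.
move=> cx e0; have [V [S1 [S2 [Vb sec]]]] := sectors_ex pv cx e0.
have dis := sectors_region cx sec; have [oV VE c1 c2 cl] := sec.
have rV r : V r -> region v r -> S1 r \/ S2 r.
  move=> Vr rr; have : (V `&` ~` curve v) r by split=> //; case: rr.
  by rewrite VE.
case: dis => dis; exists V.
  exists S2; split=> //.
  - by rewrite VE; split=> //; exact: subsetUr.
  - move=> r [Vr rr]; have [h|//] := rV r Vr rr.
    by have : (S1 `&` region v) r by []; rewrite dis.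
  - by move=> r /cl[].
exists S1; split=> //.
- by rewrite VE; split=> //; exact: subsetUl.
- move=> r [Vr rr]; have [//|h] := rV r Vr rr.
  by have : (S2 `&` region v) r by []; rewrite dis.
- by move=> r /cl[].
Qed.

Lemma side_one_sided i x : side v i x -> x <> v i -> x <> v (ordS i) ->
  exists e (g : R), [/\ 0 < e, `|g| = 1 & forall y, box x e y -> region v y ->
    0 < g * cross (y - v i) (v (ordS i) - v i)].
Proof.
move=> sx xa xb; have [e e0 he] := side_sectors pv sx xa xb.
have {}he := he e; rewrite e0 lexx in he; have {}he := he isT.
have cx : curve v x by exists i.
have dis := sectors_region cx he; have [_ VE _ _ _] := he.
have rV y : box x e y -> region v y -> 
   0 < cross (y - v i) (v (ordS i) - v i) \/ cross (y - v i) (v (ordS i) - v i) < 0.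
  move=> yb ry; have : (box x e `&` ~` curve v) y by split=> //; case: ry.
  by rewrite VE => -[[]|[]]; [left|right].
exists e; case: dis => dis; [exists (-1)|exists 1]; split; rewrite ?normrN1 ?normr1//.
  move=> y yb ry; have [h|h] := rV y yb ry; last by rewrite mulN1r oppr_gt0.
  by have : set0 y; [rewrite -dis|].
move=> y yb ry; have [h|h] := rV y yb ry; first by rewrite mul1r.
by have : set0 y; [rewrite -dis|].
Qed.

(** A connected set off the curve that contains a region point never leaves the region. The
    right-hand side has the form that [touch_local] handles. *)
Lemma region_compE O x : region v x -> O x ->
  connected_component (region v `&` O) x = connected_component (~` curve v `&` O) x.
Proof.
move=> rx Ox; apply/seteqP; split=> y [A [Ax AO cA] Ay]; exists A => //; split=> //.
  by move=> r /AO[[]].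
have Av : A `<=` ~` curve v by move=> r /AO[].
by move=> r Ar; split; [exact: (region_sub cA Av Ax rx)|case: (AO r Ar)].
Qed.

(** Contact of the first component is carried along the side to [y']; there one-sidedness puts
    nearby points of both components into one connected set. *)
Lemma closure_comp_unique O x x' y y' i : open O ->
  (region v `&` O) x -> (region v `&` O) x' ->
  side v i y -> side v i y' -> seg y y' `<=` O ->
  closure (connected_component (region v `&` O) x) y ->
  closure (connected_component (region v `&` O) x') y' ->
  connected_component (region v `&` O) x = connected_component (region v `&` O) x'.
Proof.
move=> oO [rx Ox] [rx' Ox'] sy sy' sO cly cly'.
have {}cly : closure (connected_component (region v `&` O) x) y'.
  move: cly; rewrite region_compE//; apply: seg_propagate; first exact: closed_closure.
  move=> q sq /(touch_local oO)[||e e0 he].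
  - by exists i => //; exact: (convex_seg sy sy').
  - exact: sO.
  - exists e => // r [rb sr]; apply: he; split=> //; exists i => //.
    exact: (convex_seg sy sy').
have Oy : O y' by apply: sO; exact: segr.
have [e e0 he] := (open_boxP _).1 oO y' Oy.
have cy : curve v y' by exists i.
have [V [S [[oV Vy] Vb [cS SV] rS _]]] := one_sided cy e0.
have [e' e'0 he'] := (open_boxP _).1 oV y' Vy.
have [q qb Cq] := (closure_boxP _ _).1 cly e' e'0.
have [q' qb' Cq'] := (closure_boxP _ _).1 cly' e' e'0.
have [rq _] := connected_component_sub Cq.
have [rq' _] := connected_component_sub Cq'.
have Sq : S q by apply: rS; split=> //; exact: he'.
have Sq' : S q' by apply: rS; split=> //; exact: he'.
have Sr : S `<=` region v by apply: (region_sub cS _ Sq rq) => r /SV[].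
have SG : S `<=` region v `&` O by move=> r Sr'; split; [exact: Sr|apply/he/Vb; case: (SV r Sr')].
apply: (comp_eq (z := q')) => //.
exact: (comp_sub cS SG Sq Cq).
Qed.

(** Near [p] the curve is a cone with apex [p]; read backwards, contracting towards [p] keeps a
    point off the curve. *)
Lemma conic p : exists2 e, 0 < e & forall c s j, box p e c -> 0 < s <= 1 ->
  side v j (p + s *: (c - p)) -> side v j c /\ side v j p.
Proof.
have [|e e0 he] := @uniform_radius R k (fun j e => forall c s, box p e c -> 0 < s <= 1 ->
  side v j (p + s *: (c - p)) -> side v j c /\ side v j p); last first.
  exists e => // c s j cb s01; apply: (he e) => //; by rewrite e0 lexx.
move=> j; have [sp|nsp] := pselect (side v j p); last first.
  have /open_boxP/(_ p nsp)[e e0 he] := closed_openC (@seg_closed R (v j) (v (ordS j))).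
  exists e => // e' /andP[e'0 ee] c s cb /andP[s0 s1] sj; exfalso.
  apply: (he _ (box_le ee _) sj).
  apply: (convex_box (box_refl p e'0) cb); apply/seg_param; exists s; split=> //.
  exact: ltW.
have ab := polygon_neq pv (i := j).
have sp' := sp; move: sp'; rewrite /side; set a := v j in ab *; set b := v _ in ab *.
move=> /seg_param[t0 [t00 t01 pE]].
have D0 := dot_gt0 ab; set D := dot _ _ in D0.
(* If [p] is an end of the side, 1 replaces the zero distance to that end; the bound there comes
   from the sign of [t1 - t0] instead. *)
set eta := Num.min (if t0 == 0 then 1 else t0) (if t0 == 1 then 1 else 1 - t0).
have eta0 : 0 < eta.
  rewrite /eta lt_min; apply/andP; split.
    by case: eqVneq => // h; rewrite lt_neqAle eq_sym h.
  by case: eqVneq => // h; rewrite subr_gt0 lt_neqAle h.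
have [e e0 he] := lin_small ((b - a) 0 0 / D) ((b - a) 0 1 / D) eta0.
exists e => // e' /andP[_ ee] c s /(box_le ee)[c0 c1] /andP[s0 s1].
move=> /seg_param[t1 [t10 t11 yE]]; split=> //.
have := he _ _ c0 c1.
(* Undoing the contraction by [s] gives the parameter of [c] on the line of the side. *)
set t := t0 + (t1 - t0) / s.
have cE : c = a + t *: (b - a).
  have h r : r + s *: (c - r) = (1 - s) *: r + s *: c.
    by apply: pt_eq; rewrite !mxE; ring.
  have -> : c = s^-1 *: (p + s *: (c - p)) - s^-1 *: p + p.
    rewrite -scalerBr [p + _]addrC addrK scalerA mulVf ?gt_eqF// scale1r.
    by rewrite subrK.
  rewrite yE pE /t; apply: pt_eq; rewrite !mxE; field; exact: lt0r_neq0.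
have -> : (b - a) 0 0 / D * (c 0 0 - p 0 0) + (b - a) 0 1 / D * (c 0 1 - p 0 1) = t - t0.
  have cp : c - p = (t - t0) *: (b - a).
    by rewrite cE pE; apply: pt_eq; rewrite !mxE; ring.
  have cX : c 0 0 - p 0 0 = (t - t0) * (b - a) 0 0.
    by transitivity ((c - p) 0 0); [rewrite !mxE|rewrite cp [LHS]mxE].
  have cY : c 0 1 - p 0 1 = (t - t0) * (b - a) 0 1.
    by transitivity ((c - p) 0 1); [rewrite !mxE|rewrite cp [LHS]mxE].
  transitivity ((t - t0) * (dot (b - a) (b - a) / D)); first by rewrite cX cY /dot; ring.
  by rewrite -/D divff ?mulr1// gt_eqF.
have ts : t0 = 0 -> 0 <= t by rewrite /t => ->; rewrite add0r subr0 divr_ge0// ltW.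
have ts' : t0 = 1 -> t <= 1.
  by rewrite /t => ->; rewrite gerDl pmulr_lle0 ?invr_gt0// subr_le0.
rewrite ltr_norml lt_min ltrNl lt_min => /andP[/andP[h1 h2] /andP[h3 h4]].
apply/seg_param; exists t; split=> //.
  move: h1; case: eqVneq => [/ts//|_ h]; lra.
move: h4; case: eqVneq => [/ts'//|_ h]; lra.
Qed.

End OneSided.

(** * Extreme points of a component *)

Section Extreme.
Variables (R : realType).
Implicit Types (x y z a b c d p q u : pt R) (A B S V O : set (pt R)) (e s t : R).

Lemma exit_time A c d : open A -> bounded_set A -> A c -> d <> 0 ->
  exists2 T, 0 < T & ~ A (c + T *: d) /\ forall t, 0 <= t < T -> A (c + t *: d).
Proof.
move=> oA bA Ac d0; have [K hK] := (boundedP A).1 bA.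
set E := [set t | 0 <= t /\ ~ A (c + t *: d)].
have E0 : E !=set0.
  apply: contrapT => h.
  have all t : 0 <= t -> A (c + t *: d).
    by move=> t0; apply: contrapT => nA; apply: h; exists t.
  have bnd (p q : R) : q != 0 -> (forall t, 0 <= t -> `|p + t * q| <= K) -> False.
    move=> q0 hp; have q1 : 0 < `|q| by rewrite normr_gt0.
    have h0 := hp 0 (lexx _).
    have K0 : 0 <= K by exact: le_trans h0.
    have t0 : 0 <= (2 * K + 1) / `|q| by rewrite divr_ge0 ?ltW//; lra.
    have := hp _ t0; rewrite mul0r addr0 in h0.
    have : `|(2 * K + 1) / `|q| * q| = 2 * K + 1.
      rewrite normrM normf_div normr_id mulfVK ?gt_eqF// ger0_norm //; lra.
    set w := _ * q => wE wK; have := ler_normB (p + w) p.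
    by rewrite addrC addKr wE; lra.
  apply: d0; apply: pt_eq; rewrite mxE; apply/eqP/negPn/negP => dn.
    by apply: (bnd (c 0 0) _ dn) => t /all/hK[]; rewrite !mxE.
  by apply: (bnd (c 0 1) _ dn) => t /all/hK[_]; rewrite !mxE.
have lbE : has_lbound E by exists 0 => t [].
have lt t : 0 <= t < inf E -> A (c + t *: d).
  move=> /andP[t0 tE]; apply: contrapT => nA; move: tE; rewrite ltNge => /negP; apply.
  by apply: ge_inf => //; split.
have i0 : 0 <= inf E by apply: lb_le_inf => // t [].
(* Used with [r = 0] for positivity of the exit time, and with [r = inf E] to show that the exit
   point is outside [A]. *)
have step r : 0 <= r -> (forall t, 0 <= t < r -> A (c + t *: d)) -> A (c + r *: d) -> r < inf E.
  move=> r0 hr Ar; have [e e0 he] := (open_boxP _).1 oA _ Ar.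
  have [s s0 hs] := step_box (c + r *: d) d e0.
  apply: (@lt_le_trans _ _ (r + s)); first by rewrite ltrDl.
  apply: lb_le_inf => // t [t0 nA]; rewrite leNgt; apply/negP => trs.
  have [tr|rt] := ltP t r; first by apply/nA/hr; rewrite t0.
  apply: nA; have [->//|nr] := eqVneq t r.
  have -> : c + t *: d = c + r *: d + (t - r) *: d by apply: pt_eq; rewrite !mxE; ring.
  apply/he/hs; rewrite subr_gt0 lt_neqAle eq_sym nr rt/=; lra.
exists (inf E).
  by apply: step => //; [move=> t; lra|rewrite scale0r addr0].
by split=> // /(step _ i0 lt); rewrite ltxx.
Qed.

Definition dist2 z y : R := dot (y - z) (y - z).

Lemma dist2_eq0 z y : dist2 z y <= 0 -> y = z.
Proof.
rewrite leNgt => h; apply: contrapT => zy; move/negP: h; apply.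
by apply: dot_gt0 => yz; apply: zy.
Qed.

Lemma dist2_max A z : A !=set0 -> bounded_set A ->
  exists2 p, closure A p & forall y, closure A y -> dist2 z y <= dist2 z p.
Proof.
move=> [a Aa] /boundedP[K hK].
have cA : compact (closure A).
  apply: bounded_closed_compact; last exact: closed_closure.
  apply/boundedP; exists (K + 1) => x /closure_boxP/(_ 1 ltr01)[y [y0 y1] /hK[h0 h1]].
  move: y0 y1 h0 h1; rewrite !ltr_norml !ler_norml.
  by move=> /andP[? ?] /andP[? ?] /andP[? ?] /andP[? ?]; split; lra.
have [||p] := compact_EVT_max _ cA (f := dist2 z); last first.
- move=> /set_mem cp hp; exists p => // y cy; apply: hp; exact/mem_set.
- apply: continuous_subspaceT.
  have -> : dist2 z = fun y => (y 0 0 - z 0 0) * (y 0 0 - z 0 0) +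
                               (y 0 1 - z 0 1) * (y 0 1 - z 0 1).
    by apply/funext => q; rewrite /dist2 /dot !mxE.
  have cc (i : 'I_2) : continuous (fun y : 'rV[R]_2 => y 0 i - z 0 i).
    move=> y; apply: continuousB; [exact: coord_continuous|exact: cst_continuous].
  by move=> y; exact: (continuousD (continuousM (cc 0 y) (cc 0 y))
                                   (continuousM (cc 1 y) (cc 1 y))).
- by exists a; exact: subset_closure.
Qed.

Lemma open_other A x y : open A -> A x -> exists2 s, 0 < s &
  forall s', 0 < s' <= s -> A (x + s' *: y).
Proof.
move=> oA /((open_boxP _).1 oA)[e e0 he]; have [s s0 hs] := step_box x y e0.
by exists s => // s' /hs /he.
Qed.

(** A small step along the first axis, directed away from [z], increases the distance, even when
    [p = z]. *)
Lemma dist2_max_notin A z p : open A ->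
  (forall y, closure A y -> dist2 z y <= dist2 z p) -> ~ A p.
Proof.
move=> oA h Ap.
pose g : R := if 0 <= (p - z) 0 0 then 1 else -1.
pose u : pt R := \row_k (if k == 0 then g else 0).
have [s s0 hs] := open_other u oA Ap.
have /subset_closure/h : A (p + s *: u) by apply: hs; rewrite s0 lexx.
rewrite /dist2 /dot /u !mxE /= /g; case: ifPn; rewrite -?ltNge !mxE => hg; nra.
Qed.

Variables (n m : nat) (v : 'I_n -> pt R) (w : 'I_m -> pt R).
Hypotheses (pv : is_polygon v) (pw : is_polygon w).
Let G := region v `&` region w.
Variable x0 : pt R.
Hypothesis Gx0 : G x0.
Let C := connected_component G x0.

Let GO : open G. Proof. by apply: openI; exact: region_open. Qed.
Let CO : open C. Proof. exact: comp_open. Qed.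
Let Cx0 : C x0. Proof. exact: connected_component_refl. Qed.
Let CB : bounded_set C.
Proof.
have [M _ hM] := region_bounded v; apply/boundedP; exists M => x.
by move=> /connected_component_sub[/hM].
Qed.

(** What a component can own: a contact with a side of P inside Q, or the start of the ray at a
    vertex of Q along the sum of its two edge vectors. That direction depends on the vertex only, so
    two components owning the same vertex overlap. *)
Definition item (l : 'I_n + 'I_m) : Prop :=
  match l with
  | inl i => exists y, [/\ side v i y, region w y & closure C y]
  | inr j => exists2 s0, 0 < s0 & forall s, 0 < s <= s0 ->
      C (w (ordS j) + s *: ((w j - w (ordS j)) + (w (ordS (ordS j)) - w (ordS j))))
  end.

(** Ties an item to the extreme point that produced it; two items are told apart through the
    positions of these points. *)
Definition item_at (l : 'I_n + 'I_m) p : Prop :=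
  match l with inl i => side v i p | inr j => p = w (ordS j) end.

Let frontier x : closure C x -> ~ C x -> curve v x \/ curve w x.
Proof.
move=> cx ncx; apply: contrapT => /not_orP[nv nw]; apply: ncx.
have sub : C `<=` G by exact: connected_component_sub.
apply: (@comp_closure _ G) => //; split=> //; split.
  by have [] : (region v `|` curve v) x
    by apply: region_closure; apply: closureS cx => r /sub[].
by have [] : (region w `|` curve w) x
  by apply: region_closure; apply: closureS cx => r /sub[].
Qed.

Let region_of_closure x : closure C x -> ~ curve w x -> region w x.
Proof.
move=> cx nw; have [//|//] : (region w `|` curve w) x.
by apply: region_closure; apply: closureS cx => r /connected_component_sub[].
Qed.

(** As both curves are conic at [p], the segment from [c] to its contraction crosses neither of
    them. *)
Let cone p e c s : 
  (forall c s j, box p e c -> 0 < s <= 1 -> side v j (p + s *: (c - p)) -> side v j c /\ side v j p) ->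
  (forall c s j, box p e c -> 0 < s <= 1 -> side w j (p + s *: (c - p)) -> side w j c /\ side w j p) ->
  C c -> box p e c -> 0 < s <= 1 -> C (p + s *: (c - p)).
Proof.
move=> ev ew Cc cb /andP[s0 s1]; have [rv rw] := connected_component_sub Cc.
have segE r : seg (p + s *: (c - p)) c r -> exists2 s', 0 < s' <= 1 & r = p + s' *: (c - p).
  move=> /segP[t [t0 t1 h0 h1]]; exists ((1 - t) * s + t).
    by apply/andP; split; nra.
  by apply: pt_eq; rewrite ?h0 ?h1 !mxE; ring.
have cs : connected (seg (p + s *: (c - p)) c) by exact: seg_connected.
have sv : seg (p + s *: (c - p)) c `<=` region v.
  apply: (region_sub cs _ (segr _ _) rv) => _ /segE[s' s'1 ->] [j _ /ev[]//].
  by move=> sj _; case: rv => + _; apply; exists j.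
have sw : seg (p + s *: (c - p)) c `<=` region w.
  apply: (region_sub cs _ (segr _ _) rw) => _ /segE[s' s'1 ->] [j _ /ew[]//].
  by move=> sj _; case: rw => + _; apply; exists j.
apply: (comp_sub cs _ (segr _ _) Cc); last exact: segl.
by move=> r sr; split; [exact: sv|exact: sw].
Qed.

Lemma extreme_item z : exists l p, [/\ closure C p,
  forall y, closure C y -> dist2 z y <= dist2 z p, item l & item_at l p].
Proof.
have [p cp hp] := dist2_max z (ex_intro _ x0 Cx0) CB.
have nCp := dist2_max_notin CO hp.
have [e1 e10 he1] := conic pv p; have [e2 e20 he2] := conic pw p.
pose e := Num.min e1 e2; have e0 : 0 < e by rewrite lt_min e10.
have ev c s j : box p e c -> 0 < s <= 1 -> side v j (p + s *: (c - p)) -> side v j c /\ side v j p.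
  by move=> cb; apply: he1; apply: box_le cb; rewrite ge_min lexx.
have ew c s j : box p e c -> 0 < s <= 1 -> side w j (p + s *: (c - p)) -> side w j c /\ side w j p.
  by move=> cb; apply: he2; apply: box_le cb; rewrite ge_min lexx orbT.
have coneC c s := @cone p e c s ev ew.
(* Maximality of [p] expanded: the closure of [C] lies in the disc of centre [z] through [p]. *)
have key y : closure C y -> dot (y - p) (y - p) <= - 2 * dot (y - p) (p - z).
  move=> /hp; rewrite /dist2.
  have -> : dot (y - z) (y - z) = dot (y - p) (y - p) + 2 * dot (y - p) (p - z) + dot (p - z) (p - z).
    by rewrite /dot !mxE; ring.
  lra.
have [c cb Cc] := (closure_boxP _ _).1 cp e e0.
have c_p : p <> c by move=> h; apply: nCp; rewrite h.
have h0 : dot (c - p) (p - z) < 0.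
  by have := dot_gt0 c_p; have := key c (subset_closure Cc); lra.
set nu := p - z in key h0; clearbody nu; pose h := - dot (c - p) nu.
have {}h0 : 0 < h by rewrite oppr_gt0.
(* This makes 2sh < e^2, so that by [key] the closure points on the chord line at depth [s * h] fall
   into the box. *)
pose s := Num.min 1 (e ^+ 2 / (4 * h)).
have s0 : 0 < s by rewrite lt_min ltr01 divr_gt0 ?exprn_gt0//; lra.
have s1 : s <= 1 by rewrite ge_min lexx.
have sh : 2 * (s * h) < e ^+ 2.
  have : s <= e ^+ 2 / (4 * h) by rewrite ge_min lexx orbT.
  rewrite ler_pdivlMr; last lra.
  have : 0 < e ^+ 2 by rewrite exprn_gt0.
  by nra.
pose q := p + s *: (c - p).
have Cq : C q by apply: coneC => //; rewrite s0.
pose tau : pt R := \row_k (if k == 0 then - nu 0 1 else nu 0 0).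
have qt t : dot (q + t *: tau - p) nu = - (s * h).
  by rewrite /h /q /tau /dot !mxE /=; ring.
have near y : closure C y -> dot (y - p) nu = - (s * h) -> box p e y.
  move=> /key + hy; rewrite hy /dot !mxE => k1.
  have sq (r : R) : r * r < e ^+ 2 -> `|r| < e.
    move=> hr; have : `|r| * `|r| = r * r by rewrite -normrM ger0_norm// -expr2 sqr_ge0.
    by have := normr_ge0 r; rewrite ltNge => r0 rr; apply/negP => er; nra.
  split; apply: sq.
    have := sqr_ge0 (y 0 1 - p 0 1); rewrite expr2; lra.
  have := sqr_ge0 (y 0 0 - p 0 0); rewrite expr2; lra.
have tau0 : tau <> 0.
  move=> /rowP tau0; have := tau0 0; have := tau0 1; rewrite /tau !mxE /= => n0 n1.
  by move: h0; rewrite /h /dot n0 -[nu 0 1]opprK n1; lra.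
have tau0' : - tau <> 0 by move=> /eqP; rewrite oppr_eq0 => /eqP.
have [T1 T10 [out1 in1]] := exit_time CO CB Cq tau0.
have [T2 T20 [out2 in2]] := exit_time CO CB Cq tau0'.
have chordC t : - T2 < t < T1 -> C (q + t *: tau).
  move=> /andP[t2 t1]; have [t0|t0] := lerP 0 t; first by apply: in1; rewrite t0.
  have -> : t *: tau = (- t) *: (- tau) by rewrite scalerN scaleNr opprK.
  by apply: in2; apply/andP; split; lra.
set y1 := q + T1 *: tau in out1; set y2 := q + T2 *: - tau in out2.
have cy1 : closure C y1.
  apply: (closure_step (u := - tau) T10) => r /andP[r0 rT].
  have -> : y1 + r *: - tau = q + (T1 - r) *: tau by apply: pt_eq; rewrite !mxE; ring.
  by apply: chordC; apply/andP; split; lra.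
have cy2 : closure C y2.
  apply: (closure_step (u := tau) T20) => r /andP[r0 rT].
  have -> : y2 + r *: tau = q + (r - T2) *: tau by apply: pt_eq; rewrite !mxE; ring.
  by apply: chordC; apply/andP; split; lra.
have y1b : box p e y1 by apply: near => //; exact: qt.
have y2E : y2 = q + (- T2) *: tau by rewrite /y2 scalerN scaleNr.
have y2b : box p e y2 by apply: near => //; rewrite y2E; exact: qt.
(* A chord end off the curve of Q lies on a side of P inside Q; the conic property with factor 1
   puts [p] on that side. *)
have from_v y : closure C y -> ~ C y -> box p e y -> ~ curve w y ->
   exists l p, [/\ closure C p,
     forall y, closure C y -> dist2 z y <= dist2 z p, item l & item_at l p].
  move=> cy nCy yb nw; have [[i _ si]|//] := frontier cy nCy.
  exists (inl i), p; split=> //; first by exists y; split=> //; exact: region_of_closure.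
  have [|_ //] := ev y 1 i yb (andb_true_intro (conj ltr01 (lexx 1))).
  by rewrite scale1r addrC subrK.
have [w1|] := pselect (curve w y1); last exact: from_v.
have [w2|] := pselect (curve w y2); last exact: from_v.
(* Up to a positive factor this direction leads from [p] to a weighted mean of the chord ends, a
   point of [C], so [cone] applies. *)
have corner la mu : 0 < la -> 0 < mu -> exists2 s0, 0 < s0 &
    forall s, 0 < s <= s0 -> C (p + s *: (la *: (y1 - p) + mu *: (y2 - p))).
  move=> la0 mu0; have lm : 0 < la + mu by rewrite addr_gt0.
  exists (la + mu)^-1; first by rewrite invr_gt0.
  move=> r /andP[r0 rl]; pose t := (la * T1 - mu * T2) / (la + mu).
  have -> : p + r *: (la *: (y1 - p) + mu *: (y2 - p)) =
            p + (r * (la + mu)) *: ((q + t *: tau) - p).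
    rewrite y2E /y1 /t; apply: pt_eq; rewrite !mxE; field; exact: lt0r_neq0.
  have t12 : - T2 < t < T1.
    by apply/andP; split; [rewrite ltr_pdivlMr//|rewrite ltr_pdivrMr//]; nra.
  have Ct := chordC t t12; apply: coneC => //.
    by apply: near; [exact: subset_closure|exact: qt].
  by rewrite mulr_gt0//= -ler_pdivlMr// div1r.
(* The ends are seen from [p] in independent directions, so they lie on different sides through [p],
   and [p] is a vertex. *)
have cr : cross (y1 - p) (y2 - p) != 0.
  have -> : cross (y1 - p) (y2 - p) = (T1 + T2) * (s * h).
    by rewrite y2E /y1 /q /tau /h /cross /dot !mxE /=; ring.
  by rewrite gt_eqF// !mulr_gt0// addr_gt0.
have side1 y j : box p e y -> side w j y -> side w j p.
  move=> yb sj; have [|_ //] := ew y 1 j yb (andb_true_intro (conj ltr01 (lexx 1))).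
  by rewrite scale1r addrC subrK.
have [j1 _ s1y] := w1; have [j2 _ s2y] := w2.
have s1p := side1 y1 j1 y1b s1y; have s2p := side1 y2 j2 y2b s2y.
have j12 : j1 <> j2.
  move=> j12; move: cr; rewrite -j12 in s2y s2p.
  move/seg_param: s1y => [r1 [_ _ ->]]; move/seg_param: s2y => [r2 [_ _ ->]].
  move/seg_param: s1p => [r3 [_ _ ->]].
  by rewrite /cross !mxE => /negP; apply; apply/eqP; ring.
have [j pE] : exists j, p = w (ordS j).
  have [pj|pj] := pselect (p = w j1).
    by have [j jE] := ordS_surj j1; exists j; rewrite pj -jE.
  have [pj'|pj'] := pselect (p = w (ordS j1)); first by exists j1.
  by case: j12; rewrite (side_inner pw s1p pj pj' s2p).
exists (inr j), p; split=> //=; rewrite -pE.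
(* The edge vectors at [p] are positive multiples of the directions to the chord ends, so [corner]
   yields the item. *)
have sideL y : side w j y -> (y - p) <> 0 -> exists2 la, 0 < la & w j - p = la *: (y - p).
  move=> /seg_param[t [t0 t1]]; rewrite -pE => yE yp.
  have t_1 : t != 1.
    by apply/eqP => tE; apply: yp; rewrite yE tE; apply: pt_eq; rewrite !mxE; ring.
  have t2 : 0 < 1 - t by rewrite subr_gt0 lt_neqAle t_1.
  exists (1 - t)^-1; first by rewrite invr_gt0.
  rewrite yE; apply: pt_eq; rewrite !mxE; field; exact: lt0r_neq0.
have sideR y : side w (ordS j) y -> (y - p) <> 0 ->
    exists2 la, 0 < la & w (ordS (ordS j)) - p = la *: (y - p).
  move=> /seg_param[t [t0 t1]]; rewrite -pE => yE yp.
  have t_0 : t != 0.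
    by apply/eqP => tE; apply: yp; rewrite yE tE scale0r addr0 subrr.
  have t2 : 0 < t by rewrite lt_neqAle eq_sym t_0.
  exists t^-1; first by rewrite invr_gt0.
  rewrite yE; apply: pt_eq; rewrite !mxE; field; exact: lt0r_neq0.
have y1n : y1 - p <> 0 by move=> E; move: cr; rewrite E /cross !mxE !mul0r subrr eqxx.
have y2n : y2 - p <> 0 by move=> E; move: cr; rewrite E /cross !mxE !mulr0 subrr eqxx.
rewrite pE in s1p s2p.
have [E1|E1] := side_vertex pw s1p; have [E2|E2] := side_vertex pw s2p.
- by case: j12; rewrite E1 E2.
- rewrite E1 in s1y; rewrite E2 in s2y.
  have [la la0 ->] := sideL _ s1y y1n; have [mu mu0 ->] := sideR _ s2y y2n.
  exact: corner.
- rewrite E1 in s1y; rewrite E2 in s2y.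
  have [la la0 ->] := sideL _ s2y y2n; have [mu mu0 ->] := sideR _ s1y y1n.
  by rewrite addrC; exact: corner.
- by case: j12; rewrite E1 E2.
Qed.

(** A vertex found first is avoided by measuring distances from it; a side found first is avoided by
    measuring them from a point far away on a normal to it. *)
Lemma two_items : exists l1 l2, [/\ l1 <> l2, item l1 & item l2].
Proof.
have [[i1|j1] [p1 [cp1 hp1 it1 at1]]] := extreme_item x0; last first.
  have [l2 [p2 [cp2 hp2 it2 at2]]] := extreme_item p1.
  exists (inr j1), l2; split=> // E; move: at2; rewrite -E /= -at1 => p21.
  rewrite p21 in hp2.
  have all y : C y -> y = p1.
    move=> /subset_closure/hp2 h; apply: dist2_eq0; apply: le_trans h _.
    by rewrite /dist2 /dot !mxE !subrr !mul0r addr0.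
  have [s s0 hs] := open_other (const_mx 1) CO Cx0.
  have := all _ (hs s _); rewrite s0 lexx => /(_ isT).
  rewrite (all _ Cx0) => /rowP/(_ 0); rewrite !mxE; lra.
set a := v i1; set d := v (ordS i1) - a.
pose nu : pt R := \row_k (if k == 0 then d 0 1 else - d 0 0).
have fE y : cross (y - a) d = dot (y - a) nu.
  by rewrite /cross /dot /nu !mxE /=; ring.
have D0 : 0 < dot d d by apply: dot_gt0; exact: polygon_neq.
have nn : dot nu nu = dot d d by rewrite /dot /nu !mxE /=; ring.
(* [C] is open, so it is not contained in the line of the side. *)
have [c Cc fc] : exists2 c, C c & cross (c - a) d != 0.
  have [f0|f0] := eqVneq (cross (x0 - a) d) 0; last by exists x0.
  have [s s0 hs] := open_other nu CO Cx0.
  exists (x0 + s *: nu); first by apply: hs; rewrite s0 lexx.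
  have -> : cross (x0 + s *: nu - a) d = cross (x0 - a) d + s * dot nu nu.
    by rewrite !fE /dot !mxE; ring.
  by rewrite f0 add0r nn mulf_neq0 ?gt_eqF.
have [_ [p' [_ hp' _ _]]] := extreme_item a.
pose K := dist2 a p'; pose g := cross (c - a) d.
have g2 : 0 < g ^+ 2 by rewrite exprn_even_gt0.
have K0 : 0 <= K by rewrite /K /dist2 /dot addr_ge0// -expr2 sqr_ge0.
(* Moving the centre gains 2Mg^2 = K + 1 at [c] beyond a common constant, while closure points on
   the line gain nothing and start from at most [K]. *)
pose M := (K + 1) / (2 * g ^+ 2).
have distE y : dist2 (a - (M * g) *: nu) y =
    dist2 a y + 2 * (M * g) * cross (y - a) d + (M * g) ^+ 2 * dot nu nu.
  by rewrite fE /dist2 /dot !mxE; ring.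
have [l2 [p2 [cp2 hp2 it2 at2]]] := extreme_item (a - (M * g) *: nu).
exists (inl i1), l2; split=> // E; move: at2; rewrite -E /= => /seg_param[t [_ _ p2E]].
have f2 : cross (p2 - a) d = 0 by rewrite p2E /cross /d /a !mxE; ring.
have := hp2 c (subset_closure Cc); rewrite !distE f2 -/g mulr0 addr0.
have := hp' p2 cp2; rewrite -/K => k1.
have : 0 <= dist2 a c by rewrite /dist2 /dot addr_ge0// -expr2 sqr_ge0.
have : 2 * (M * g) * g = K + 1.
  by rewrite /M; field; move: g2; rewrite expr2 => g2; apply/eqP => g0; move: g2; rewrite g0 mul0r ltxx.
move=> -> k2 k3; lra.
Qed.

End Extreme.

(** * Counting *)

Section LineBound.
Variables (R : realType).
Implicit Types (x y z a c d p q u : pt R) (A S V O : set (pt R)) (e s t : R).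

Let sg (b : bool) : R := if b then 1 else -1.

Lemma cross_eq0_scale d u : d <> 0 -> u <> 0 -> cross d u = 0 ->
  exists2 r : R, r != 0 & u = r *: d.
Proof.
move=> d0 u0 cdu; have d0' : 0 <> d by move/esym.
exists (dot u d / dot d d).
  apply/eqP => r0; apply: u0.
  have : u = (dot u d / dot d d) *: d; last by rewrite r0 scale0r.
  have := @cross_eq0_param R 0 d u; rewrite !subr0 add0r; apply => //.
  by move: cdu; rewrite /cross => cdu; lra.
have := @cross_eq0_param R 0 d u; rewrite !subr0 add0r; apply => //.
by move: cdu; rewrite /cross => cdu; lra.
Qed.

Variables (m : nat) (w : 'I_m -> pt R) (d : pt R).
Hypotheses (pw : is_polygon w) (d0 : d <> 0).

(* x ends an interval of the region on a line of direction d, reached in the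
   direction +d or -d according to b. *)
Let is_end x (b : bool) := curve w x /\
  exists2 T, 0 < T & forall t, 0 < t <= T -> region w (x - (t * sg b) *: d).

Let edge j := w (ordS j) - w j.

(** A side along the line cannot overlap the interval ending at [x], whose points are off the curve;
    so it points away from the interval. *)
Let end_away x b i u (r : R) : (forall s, 0 <= s <= 1 -> side w i (x + s *: u)) ->
  r != 0 -> u = r *: d -> is_end x b -> 0 < sg b * r.
Proof.
move=> sd r0 uE [_ [T T0 hT]]; rewrite ltNge; apply/negP => br.
have r2 : 0 < r ^+ 2 by rewrite exprn_even_gt0.
have sr : sg b * r != 0 by rewrite mulf_neq0// /sg; case: (b); rewrite ?oppr_eq0 oner_eq0.
pose k := - (sg b * r) / r ^+ 2.
have k0 : 0 < k by rewrite divr_gt0// oppr_gt0 lt_neqAle sr.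
have kr : k * r = - sg b by rewrite /k; field.
pose t := Num.min T k^-1; have t0 : 0 < t by rewrite lt_min T0 invr_gt0.
have [|nc _] := hT t; first by rewrite t0 ge_min lexx.
apply: nc; exists i => //.
have -> : x - (t * sg b) *: d = x + (t * k) *: u.
  by rewrite uE scalerA -mulrA kr mulrN scaleNr.
apply: sd; apply/andP; split; first by rewrite mulr_ge0// ltW.
by rewrite -ler_pdivlMr// div1r ge_min lexx orbT.
Qed.

(** Intervals can arrive at [x] from both directions only if [x] is a vertex with both sides
    transverse to [d], and then there is one side for each. *)
Let end_sides x : exists f : bool -> 'I_m,
  (forall b, is_end x b -> side w (f b) x /\ cross d (edge (f b)) != 0) /\
  (is_end x true -> is_end x false -> f true <> f false).
Proof.
have m0 : (0 < m)%N by case: pw => /(leq_trans _) ->.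
have [cx|ncx] := pselect (curve w x); last first.
  by exists (fun=> Ordinal m0); split=> [b []|[]].
have [j _ sj] := cx.
have vertex i : x = w (ordS i) -> exists f : bool -> 'I_m,
    (forall b, is_end x b -> side w (f b) x /\ cross d (edge (f b)) != 0) /\
    (is_end x true -> is_end x false -> f true <> f false).
  move=> xE; set i' := ordS i in xE *.
  have sx : side w i x by rewrite xE; exact: segr.
  have sx' : side w i' x by rewrite xE; exact: segl.
  have uu := polygon_cross pw i; rewrite -/i' -xE in uu.
  pose u := w i - x; pose u' := w (ordS i') - x; rewrite -/u -/u' in uu.
  have u0 : u <> 0 by move=> E; move: uu; rewrite E /cross !mxE !mul0r subrr eqxx.
  have u'0 : u' <> 0 by move=> E; move: uu; rewrite E /cross !mxE !mulr0 subrr eqxx.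
  have edgeE : cross d (edge i) = - cross d u.
    by rewrite /edge /u -/i' -xE /cross !mxE; ring.
  have edgeE' : cross d (edge i') = cross d u' by rewrite /edge /u' -xE.
  have line s : 0 <= s <= 1 -> side w i (x + s *: u).
    move=> /andP[s0 s1]; apply/seg_param; exists (1 - s); rewrite -/i' -xE.
    split; [lra|lra|]; apply: pt_eq; rewrite /u !mxE; ring.
  have line' s : 0 <= s <= 1 -> side w i' (x + s *: u').
    by move=> /andP[s0 s1]; apply/seg_param; exists s; rewrite -xE.
  have once k r y : (forall s, 0 <= s <= 1 -> side w k (x + s *: y)) -> r != 0 ->
      y = r *: d -> is_end x true -> is_end x false -> False.
    move=> ly r0 yE e1 e2; have := end_away ly r0 yE e1; have := end_away ly r0 yE e2.
    by rewrite /sg; lra.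
  have [cu|cu] := eqVneq (cross d u) 0.
    have [r r0 uE] := cross_eq0_scale d0 u0 cu.
    have cu' : cross d u' != 0.
      apply/eqP => cu'; have [r' _ uE'] := cross_eq0_scale d0 u'0 cu'.
      by move: uu; rewrite uE uE' /cross !mxE => /negP; apply; apply/eqP; ring.
    exists (fun=> i'); split; first by move=> b _; rewrite edgeE'.
    by move=> e1 e2; case: (once _ _ _ line r0 uE e1 e2).
  have [cu'|cu'] := eqVneq (cross d u') 0.
    have [r r0 uE] := cross_eq0_scale d0 u'0 cu'.
    exists (fun=> i); split; first by move=> b _; rewrite edgeE oppr_eq0.
    by move=> e1 e2; case: (once _ _ _ line' r0 uE e1 e2).
  exists (fun b => if b then i else i'); split.
    by case=> _; rewrite ?edgeE ?edgeE' ?oppr_eq0.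
  by move=> _ _ ii; have := polygon_neq pw (i := i); rewrite -/i' -ii.
have [xj|xj] := pselect (x = w j).
  by have [i iE] := ordS_surj j; apply: (vertex i); rewrite xj iE.
have [xj'|xj'] := pselect (x = w (ordS j)); first exact: vertex xj'.
have [e [g [e0 g1 hg]]] := side_one_sided pw sj xj xj'.
have cx0 : cross (x - w j) (edge j) = 0.
  by move/seg_param: sj => [t [_ _ ->]]; rewrite /edge /cross !mxE; ring.
(* Near [x] the region lies on one side of the line of side [j], which fixes the sign of the
   crossing: it is not zero, and the two values of [b] exclude each other. *)
have sgn b : is_end x b -> 0 < - (g * (sg b * cross d (edge j))).
  move=> [_ [T T0 hT]]; have [s s0 hs] := step_box x (- sg b *: d) e0.
  pose t := Num.min T s; have t0 : 0 < t by rewrite lt_min T0.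
  have E : x - (t * sg b) *: d = x + t *: (- sg b *: d).
    by rewrite scalerA mulrN scaleNr.
  have := hg (x - (t * sg b) *: d); rewrite {1}E => /(_ (hs t _) (hT t _)).
  rewrite !t0 !ge_min !lexx orbT => /(_ isT isT).
  have -> : cross (x - (t * sg b) *: d - w j) (w (ordS j) - w j) =
     cross (x - w j) (edge j) - t * (sg b * cross d (edge j)).
    by rewrite /edge /cross !mxE; ring.
  by rewrite cx0 sub0r mulrN mulrCA -mulrN pmulr_rgt0.
exists (fun=> j); split.
  move=> b /sgn h; split=> //; apply/eqP => c0; move: h.
  by rewrite c0 !mulr0 oppr0 ltxx.
move=> /sgn h1 /sgn h2; exfalso; move: h1 h2; rewrite /sg; lra.
Qed.

(** Each point is followed to both ends of its interval. The charge is injective because a side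
    determines the end, then the direction, then the interval. *)
Lemma line_bound (T : finType) (a : pt R) (tau : T -> R) :
  (forall k, region w (a + tau k *: d)) ->
  (forall k l, k <> l -> ~ seg (a + tau k *: d) (a + tau l *: d) `<=` region w) ->
  (2 * #|T| <= m)%N.
Proof.
move=> hr sep; pose y k := a + tau k *: d.
have sd b : sg b *: d <> 0.
  by rewrite /sg; case: b; rewrite ?scale1r// scaleN1r => /eqP; rewrite oppr_eq0 => /eqP.
have bR : bounded_set (region w).
  by have [M _ hM] := region_bounded w; apply/boundedP; exists M.
have /choice[f hf] : forall kb : T * bool, exists t, 0 < t /\
    (~ region w (y kb.1 + t *: (sg kb.2 *: d)) /\
     forall s, 0 <= s < t -> region w (y kb.1 + s *: (sg kb.2 *: d))).
  move=> [k b]; have [t t0 ht] := exit_time (@region_open _ _ w) bR (hr k) (sd b).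
  by exists t.
pose x kb := y kb.1 + f kb *: (sg kb.2 *: d).
have xend kb : is_end (x kb) kb.2.
  have [f0 [out ins]] := hf kb; split.
    have : closure (region w) (x kb).
      apply: (closure_step (u := - (sg kb.2 *: d)) f0) => s /andP[s0 sf].
      have -> : x kb + s *: - (sg kb.2 *: d) = y kb.1 + (f kb - s) *: (sg kb.2 *: d).
        by rewrite /x scalerN scalerBl addrA.
      by apply: ins; apply/andP; split; lra.
    by move=> /region_closure[rx|//]; case: (out rx).
  exists (f kb) => // s /andP[s0 sf].
  have -> : x kb - (s * sg kb.2) *: d = y kb.1 + (f kb - s) *: (sg kb.2 *: d).
    by rewrite /x scalerBl addrA !scalerA.
  by apply: ins; apply/andP; split; lra.
have /choice[h hh] := end_sides.
have inj : injective (fun kb => h (x kb) kb.2).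
  move=> kb lc E.
  have [s1 c1] := (hh (x kb)).1 _ (xend kb).
  have [s2 c2] := (hh (x lc)).1 _ (xend lc).
  have xE : x kb = x lc.
    move: s1 s2 c2; rewrite E; set j := h _ _.
    move=> /seg_param[r1 [_ _ E1]] /seg_param[r2 [_ _ E2]] cj.
    have [rho dE] : exists rho, x kb - x lc = rho *: d.
      exists (tau kb.1 + f kb * sg kb.2 - (tau lc.1 + f lc * sg lc.2)).
      by rewrite /x /y !scalerA; apply: pt_eq; rewrite !mxE; ring.
    have : (r1 - r2) * cross d (edge j) = 0.
      have -> : (r1 - r2) * cross d (edge j) = cross d (x kb - x lc).
        by rewrite E1 E2 /edge /cross !mxE; ring.
      by rewrite dE /cross !mxE; ring.
    move=> /eqP; rewrite mulf_eq0 (negPf cj) orbF subr_eq0 => /eqP r12.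
    by rewrite E1 E2 r12.
  have bE : kb.2 = lc.2.
    have e1 := xend kb; have e2 := xend lc; rewrite xE in e1.
    have := (hh (x lc)).2; move: E; rewrite xE.
    case: kb.2 e1; case: lc.2 e2 => // e2 e1 E h12;
      [case: (h12 e1 e2)|case: (h12 e2 e1)]; by rewrite E.
  suff kE : kb.1 = lc.1 by case: kb lc kE bE {E s1 c1 s2 c2 xE} => ? ? [? ?] /= -> ->.
  (* The point nearer to the common end lies on the path of the other one, which stays in the region
     until its exit. *)
  have key (p q : T * bool) : x p = x q -> p.2 = q.2 -> f p <= f q -> p.1 = q.1.
    move=> xpq bpq fpq; apply: contrapT => /sep; apply.
    have yE : y p.1 = y q.1 + (f q - f p) *: (sg q.2 *: d).
      move: xpq; rewrite /x bpq => xpq; apply: (addIr (f p *: (sg q.2 *: d))).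
      by rewrite xpq -[RHS]addrA -scalerDl subrK.
    rewrite -/(y p.1) -/(y q.1) yE => z /seg_param[t [t0 t1 ->]].
    have -> : y q.1 + (f q - f p) *: (sg q.2 *: d) +
        t *: (y q.1 - (y q.1 + (f q - f p) *: (sg q.2 *: d))) =
        y q.1 + ((1 - t) * (f q - f p)) *: (sg q.2 *: d).
      by apply: pt_eq; rewrite !mxE; ring.
    have [fp0 _] := hf p; have [fq0 [_ ins]] := hf q.
    by apply: ins; apply/andP; split; nra.
  have [le|/ltW le] := lerP (f kb) (f lc); first exact: key.
  by apply/esym/key.
have := leq_card _ inj; rewrite card_prod card_bool card_ord mulnC.
exact.
Qed.

End LineBound.

(** * Counting items by sides of P and vertices of Q *)

Section Upper.
Variables (R : realType) (n m c : nat) (v : 'I_n -> pt R) (w : 'I_m -> pt R).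
Hypotheses (pv : is_polygon v) (pw : is_polygon w).

Lemma ncomp_upper : ncomp_ge (region v `&` region w) c -> (2 * c <= n * m./2 + m)%N.
Proof.
move=> [F [Finj FC]]; set G := _ `&` _ in FC.
have /choice[x hx] : forall a, exists x, G x /\ connected_component G x = F a.
  by move=> a; have [x Gx xE] := FC a; exists x.
have /choice[lab hlab] : forall a, exists l : bool -> 'I_n + 'I_m,
    l true <> l false /\ forall b, item v w (x a) (l b).
  move=> a; have [l1 [l2 [l12 i1 i2]]] := two_items pv pw (hx a).1.
  by exists (fun b => if b then l1 else l2); split=> // -[].
pose L (p : 'I_c * bool) := lab p.1 p.2.
(* The two labels of a component differ, so distinct pairs in one fibre of [L] have distinct
   components. *)
have Linj (p q : 'I_c * bool) : L p = L q -> p.1 = q.1 -> p = q.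
  move: p q => [a b] [a' b']; rewrite /L /= => + aE; rewrite -aE => LE.
  have [ne _] := hlab a; case: b b' LE => -[] // LE; by case: ne.
have Feq a a' : connected_component G (x a) = connected_component G (x a') -> a = a'.
  by rewrite (hx a).2 (hx a').2 => /Finj.
have fibl i : (#|[pred p | L p == inl i]| <= m./2)%N.
  rewrite -card_sig; pose T : finType := {p : 'I_c * bool | L p == inl i}.
  have /choice[y hy] : forall p : T, exists y, [/\ side v i y, region w y &
      closure (connected_component G (x (val p).1)) y].
    move=> [p /= /eqP Lp]; have := (hlab p.1).2 p.2.
    by rewrite -/(L p) Lp.
  have /choice[tau htau] : forall p : T, exists t, y p = v i + t *: (v (ordS i) - v i).
    by move=> p; have [/seg_param[t [_ _ yE]] _ _] := hy p; exists t.
  have d0 : v (ordS i) - v i <> 0.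
    by move/eqP; rewrite subr_eq0 => /eqP/esym; exact: polygon_neq.
  rewrite geq_half_double -mul2n; apply: (line_bound (d := v (ordS i) - v i) (a := v i) (tau := tau) pw d0).
    by move=> p; rewrite -htau; case: (hy p).
  (* Were the piece of the side between two contacts inside Q, both contacts would belong to the
     same component. *)
  move=> p q pq; rewrite -!htau => sub; apply: pq; apply: val_inj.
  have [sp _ cp] := hy p; have [sq _ cq] := hy q.
  apply: Linj; first by rewrite (eqP (valP p)) (eqP (valP q)).
  apply: Feq.
  exact: (closure_comp_unique pv (region_open (v := w)) (hx _).1 (hx _).1 sp sq sub cp cq).
have fibr j : (#|[pred p | L p == inr j]| <= 1)%N.
  apply/card_le1_eqP => p q; rewrite !inE => /eqP Lp /eqP Lq.
  apply: Linj; first by rewrite Lp Lq.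
  apply: Feq.
  have := (hlab p.1).2 p.2; rewrite -/(L p) Lp => -[s s0 hs].
  have := (hlab q.1).2 q.2; rewrite -/(L q) Lq => -[r r0 hr].
  (* Both rays leave the vertex in the same direction, so a common small step gives a common
     point. *)
  have t0 : 0 < Num.min s r by rewrite lt_min s0.
  have ts : 0 < Num.min s r <= s by rewrite t0 ge_min lexx.
  have tr : 0 < Num.min s r <= r by rewrite t0 ge_min lexx orbT.
  exact: (comp_eq (hr _ tr) (hs _ ts)).
have -> : (2 * c = #|{: 'I_c * bool}|)%N by rewrite card_prod card_bool card_ord mulnC.
rewrite -sum1_card (partition_big L predT)//= big_sumType/=; apply: leq_add.
  rewrite -[n in (n * _)%N]card_ord -sum_nat_const; apply: leq_sum => i _.
  by rewrite sum1_card; exact: fibl.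
rewrite -[m in leqRHS]card_ord -sum1_card; apply: leq_sum => j _.
by rewrite sum1_card; exact: fibr.
Qed.

End Upper.

(** * The zigzag polygon *)

Section Inner.
Variables (R : realType).
Implicit Types (x y z a b : pt R) (A C I : set (pt R)) (e s t : R).

Definition lipschitz2 (f : pt R -> R) (K : R) := forall x y,
  `|f x - f y| <= K * (`|x 0 0 - y 0 0| + `|x 0 1 - y 0 1|).

Lemma lip_box f K x eta : 0 < K -> lipschitz2 f K -> 0 < eta ->
  exists2 e, 0 < e & forall y, box x e y -> `|f y - f x| < eta.
Proof.
move=> K0 lf eta0; exists (eta / (2 * K)); first by rewrite divr_gt0 ?mulr_gt0.
move=> y [y0 y1]; apply: le_lt_trans (lf y x) _.
by move: y0 y1; rewrite !ltr_pdivlMr ?mulr_gt0// => y0 y1; nra.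
Qed.

Lemma lip_open f K : 0 < K -> lipschitz2 f K -> open [set x | 0 < f x].
Proof.
move=> K0 lf; apply/open_boxP => x fx.
have [e e0 he] := lip_box x K0 lf fx; exists e => // y /he /=.
by rewrite ltr_norml => /andP[h _]; lra.
Qed.

Lemma lip_closure f K A x : 0 < K -> lipschitz2 f K ->
  A `<=` [set x | 0 < f x] -> closure A x -> 0 <= f x.
Proof.
move=> K0 lf Af /closure_boxP cx; rewrite leNgt; apply/negP => fx.
have [|e e0 he] := @lip_box f K x (- f x) K0 lf; first by rewrite oppr_gt0.
have [y /he + /Af /=] := cx e e0; rewrite ltr_norml => /andP[_ h]; lra.
Qed.

Lemma lip_opp f K : lipschitz2 f K -> lipschitz2 (fun x => - f x) K.
Proof. by move=> lf x y; rewrite -opprD normrN. Qed.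

(** Without zeros on [C], positivity of [f] is both open and closed there. *)
Lemma connected_sign f K C x y : 0 < K -> lipschitz2 f K -> connected C ->
  (forall z, C z -> f z <> 0) -> C x -> C y -> 0 < f x -> 0 < f y.
Proof.
move=> K0 lf cC nz Cx Cy fx.
suff h : C `&` [set z | 0 < f z] = C by move: Cy; rewrite -h => -[].
apply: cC; first by exists x.
  by exists [set z | 0 < f z] => //; exact: (lip_open K0 lf).
exists (~` [set z | 0 < - f z]).
  by apply: open_closedC; exact: (lip_open K0 (lip_opp lf)).
apply/seteqP; split=> z /= [Cz fz]; split=> //; first by rewrite oppr_gt0; lra.
by have := nz z Cz; move: fz; rewrite oppr_gt0; case: ltgtP => // _ _ /(_ (erefl _)).
Qed.

(** The frontier of [I] lies on the curve, so relative to the complement of the curve [I] is closed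
    as well as open. *)
Definition inner k (v : 'I_k -> pt R) I :=
  [/\ open I, bounded_set I & closure I `<=` I `|` curve v].

Lemma inner_sub k (v : 'I_k -> pt R) I A x : inner v I -> connected A ->
  A `<=` ~` curve v -> A x -> I x -> A `<=` I.
Proof.
move=> [oI _ cI] cA Av Ax Ix.
suff h : A `&` I = A by move=> z; rewrite -h => -[].
apply: cA; first by exists x.
  by exists I.
exists (closure I); first exact: closed_closure.
apply/seteqP; split=> z [Az Iz]; split=> //; first exact: subset_closure.
by case: (cI z Iz) => // /(Av z Az).
Qed.

Lemma inner_region k (v : 'I_k -> pt R) I : inner v I -> I `<=` ~` curve v ->
  I `<=` region v.
Proof.
move=> iI Iv x Ix; split; first exact: Iv.
have : connected_component (~` curve v) x `<=` I.
  apply: (inner_sub (x := x) iI) => //; first exact: component_connected.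
    exact: connected_component_sub.
  by apply: connected_component_refl; exact: Iv.
case: iI => _ /boundedP[M hM] _ sub; apply/boundedP; exists M => z /sub; exact: hM.
Qed.

Definition mk (p q : R) : pt R := \row_k (if k == 0 then p else q).

Lemma mk0 p q : mk p q 0 0 = p. Proof. by rewrite mxE. Qed.
Lemma mk1 p q : mk p q 0 1 = q. Proof. by rewrite mxE. Qed.

Definition swap x : pt R := mk (x 0 1) (x 0 0).

Lemma seg_swap a b x : seg (swap a) (swap b) x <-> seg a b (swap x).
Proof.
by split=> /segP[t [t0 t1 h0 h1]]; apply/segP; exists t; move: h0 h1;
  rewrite /swap !mk0 !mk1.
Qed.

Lemma box_swap x y e : box x e y -> box (swap x) e (swap y).
Proof. by move=> [h0 h1]; split; rewrite /swap ?mk0 ?mk1. Qed.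

Lemma swapK : involutive swap.
Proof. by move=> x; apply: pt_eq; rewrite /swap ?mk0 ?mk1. Qed.

Lemma curve_swap k (v : 'I_k -> pt R) x : curve (swap \o v) x <-> curve v (swap x).
Proof. by split=> -[i _ /seg_swap sx]; exists i. Qed.

Lemma polygon_swap k (v : 'I_k -> pt R) : is_polygon v -> is_polygon (swap \o v).
Proof.
move=> [k3 adj dis col].
have sideE i x : side (swap \o v) i x <-> side v i (swap x) by exact: seg_swap.
split=> //.
- move=> i; apply/seteqP; split=> x; last first.
    by move=> ->; split; [exact: segr|exact: segl].
  move=> [/sideE h1 /sideE h2]; have : (side v i `&` side v (ordS i)) (swap x) by [].
  by rewrite adj => /= /(congr1 swap); rewrite swapK.
- move=> i j ij ji ij'; apply/seteqP; split=> x // [/sideE h1 /sideE h2].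
  by have : (side v i `&` side v j) (swap x) by []; rewrite dis.
- move=> i; have := col i; rewrite /collinear /= !mxE /= => h1 h2; apply: h1; lra.
Qed.

Lemma inner_swap k (v : 'I_k -> pt R) I : inner v I -> inner (swap \o v) (swap @^-1` I).
Proof.
move=> [oI bI cI]; split.
- apply/open_boxP => x /((open_boxP _).1 oI)[e e0 he]; exists e => // y /box_swap.
  exact: he.
- have /boundedP[M hM] := bI; apply/boundedP; exists M => x /hM; rewrite /swap mk0 mk1.
  by move=> [].
- move=> x /closure_boxP cx; have : closure I (swap x).
    apply/closure_boxP => e /cx[y yb Iy]; exists (swap y) => //; exact: box_swap.
  by move=> /cI[|/curve_swap]; [left|right].
Qed.

Lemma segC a b x : seg a b x -> seg b a x.
Proof.
move=> /segP[t [t0 t1 h0 h1]]; apply/segP; exists (1 - t).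
by split; [lra|lra|rewrite h0; ring|rewrite h1; ring].
Qed.

Lemma seg_graph a b x : a 0 0 < b 0 0 -> seg a b x <->
  a 0 0 <= x 0 0 <= b 0 0 /\
  (x 0 1 - a 0 1) * (b 0 0 - a 0 0) = (b 0 1 - a 0 1) * (x 0 0 - a 0 0).
Proof.
move=> ab; split=> [/segP[t [t0 t1 -> ->]]|[/andP[h0 h1] h]].
  have p0 : 0 <= t * (b 0 0 - a 0 0) by rewrite mulr_ge0// subr_ge0 ltW.
  have p1 : 0 <= (1 - t) * (b 0 0 - a 0 0) by rewrite mulr_ge0 ?subr_ge0// ltW.
  by split; [apply/andP; split; lra|ring].
have d0 : b 0 0 - a 0 0 != 0 by rewrite subr_eq0 gt_eqF.
apply/segP; exists ((x 0 0 - a 0 0) / (b 0 0 - a 0 0)); split.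
- by rewrite divr_ge0// subr_ge0// ltW.
- by rewrite ler_pdivrMr ?subr_gt0// mul1r lerD2r.
- by field.
- apply: (mulIf d0); apply: (addIr (- a 0 1 * (b 0 0 - a 0 0))).
  by rewrite -mulrDl h; field.
Qed.

Lemma seg_vertical a b x : a 0 0 = b 0 0 -> a 0 1 < b 0 1 -> seg a b x <->
  x 0 0 = a 0 0 /\ a 0 1 <= x 0 1 <= b 0 1.
Proof.
move=> ab0 ab; split=> [/segP[t [t0 t1 -> ->]]|[h /andP[h0 h1]]].
  have p0 : 0 <= t * (b 0 1 - a 0 1) by rewrite mulr_ge0// subr_ge0 ltW.
  have p1 : 0 <= (1 - t) * (b 0 1 - a 0 1) by rewrite mulr_ge0 ?subr_ge0// ltW.
  by rewrite -ab0; split; [ring|apply/andP; split; lra].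
have d0 : b 0 1 - a 0 1 != 0 by rewrite subr_eq0 gt_eqF.
apply/segP; exists ((x 0 1 - a 0 1) / (b 0 1 - a 0 1)); split.
- by rewrite divr_ge0// subr_ge0// ltW.
- by rewrite ler_pdivrMr ?subr_gt0// mul1r lerD2r.
- by rewrite h -ab0; ring.
- by field.
Qed.

End Inner.

(** * The zigzag: simplicity of the curve and description of its inside *)

Section Zigzag.
Variables (R : realType) (N : nat) (H : R).
Hypotheses (N0 : (0 < N)%N) (H0 : 0 < H).
Implicit Types (x y : pt R).

Definition height (i : nat) : R := if odd i then -1 else H.
(** The closing line through (0, H), twice as steep as the teeth, which have slopes H + 1 and -(H +
    1); from abscissa 1 on it is below level -1. *)
Definition lower (r : R) : R := H - (2 * H + 2) * r.

Definition zvertex (i : nat) : pt R :=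
  if (i <= N)%N then mk i%:R (height i) else mk N%:R (lower N%:R).

Definition zigzag (i : 'I_N.+2) : pt R := zvertex i.

Let on_side (i : nat) x : Prop :=
  if (i < N)%N then i%:R <= x 0 0 <= i%:R + 1 /\
    x 0 1 = height i + (height i.+1 - height i) * (x 0 0 - i%:R)
  else if i == N then x 0 0 = N%:R /\ lower N%:R <= x 0 1 <= height N
  else 0 <= x 0 0 <= N%:R /\ x 0 1 = lower (x 0 0).

Let N1 : 1 <= N%:R :> R. Proof. by rewrite ler1n. Qed.

Let height_ge i : -1 <= height i.
Proof. have h0 := H0; rewrite /height; case: (odd i); lra. Qed.

Let lowerN : lower N%:R < height N.
Proof. by have h0 := H0; have n1 := N1; rewrite /lower; have := height_ge N; nra. Qed.

Let ordSE (i : 'I_N.+2) : val (ordS i) = if (i == N.+1 :> nat) then 0 else i.+1.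
Proof.
rewrite /=; case: eqP => [->|ni]; first by rewrite modnn.
by rewrite modn_small// ltnS ltn_neqAle -ltnS ltn_ord andbT; apply/eqP.
Qed.

Let sideE (i : 'I_N.+2) x : side zigzag i x <-> on_side i x.
Proof.
have h0 := H0; have n1 := N1.
rewrite /side /zigzag ordSE /on_side /zvertex.
have [iN|iN] := ltnP i N.
  rewrite (ltnW iN) (ltn_eqF (leqW iN)) iN.
  rewrite seg_graph ?mk0 ?mk1 -?natr1; last by rewrite ltrDl.
  by rewrite [_ + 1 - _]addrC addKr mulr1; split=> -[h E]; split=> //; lra.
have [->|ni] := eqVneq (i : nat) N.
  rewrite leqnn (ltn_eqF (ltnSn N)) /= ltnn.
  split=> [/segC|] h; [|apply: segC]; move: h; rewrite seg_vertical ?mk0 ?mk1//.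
have -> : i = N.+1 :> nat.
  by apply/eqP; rewrite eqn_leq -ltnS ltn_ord/= ltn_neqAle eq_sym ni.
rewrite ltnn eqxx /=.
have L : 0 < N%:R :> R by lra.
split=> [/segC|[h E]]; last apply: segC.
  rewrite seg_graph ?mk0 ?mk1//= subr0 => -[h E]; split=> //.
  apply: (mulIf (lt0r_neq0 L)); move: E; rewrite /height /lower /=; lra.
rewrite seg_graph ?mk0 ?mk1//= E; split=> //; rewrite /height /lower /=; ring.
Qed.

(** Tooth sides share abscissae only at common ends, and the closing side runs strictly below the
    teeth except at abscissa 0. *)
Let meet (i j : nat) x : (i < j)%N -> (j <= N.+1)%N -> on_side i x -> on_side j x ->
  (j = i.+1 /\ x = zvertex j) \/ [/\ i = 0, j = N.+1 & x = zvertex 0].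
Proof.
have h0 := H0; have n1 := N1; move=> ij jN; rewrite /on_side.
have [jN'|Nj] := ltnP j N.
  rewrite (ltn_trans ij jN') => -[/andP[a1 a2] a3] [/andP[b1 b2] b3].
  have le : i%:R + 1 <= j%:R :> R by rewrite natr1 ler_nat.
  have ji : j = i.+1.
    by apply/eqP; rewrite eqn_leq ij andbT -(ler_nat R) -natr1; lra.
  left; split=> //; rewrite /zvertex (ltnW jN'); apply: pt_eq; rewrite ?mk0 ?mk1; first lra.
  have xj : x 0 0 = j%:R by lra.
  by rewrite b3 xj; ring.
have [jE|jN'] := eqVneq j N.
  rewrite jE in ij *; rewrite ij => -[/andP[a1 a2] a3] [b1 b2].
  have iN : N = i.+1.
    by apply/eqP; rewrite eqn_leq ij andbT -(ler_nat R) -natr1; lra.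
  left; split=> //; rewrite /zvertex leqnn; apply: pt_eq; rewrite ?mk0 ?mk1//.
  by rewrite a3 b1 iN -natr1; ring.
have {jN Nj jN'} jE : j = N.+1 by apply/eqP; rewrite eqn_leq jN ltn_neqAle eq_sym jN'.
rewrite jE in ij *; have [iN|Ni] := ltnP i N; last first.
  have -> : i = N by apply/eqP; rewrite eqn_leq Ni andbT -ltnS.
  rewrite eqxx => -[a1 _] [_ b2]; left; split=> //.
  by rewrite /zvertex ltnn; apply: pt_eq; rewrite ?mk0 ?mk1// b2 a1.
move=> [/andP[a1 a2] a3] [/andP[b1 b2] b3]; case: i => [|i] in ij iN a1 a2 a3 *.
  right; split=> //; move: a3; rewrite b3 /height /lower /= => a3.
  have x0 : x 0 0 = 0 by nra.
  by rewrite /zvertex /=; apply: pt_eq; rewrite ?mk0 ?mk1// b3 x0 /lower /height /=; ring.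
have i1 : 1 <= i.+1%:R :> R by rewrite ler1n.
have := height_ge i.+1; have := height_ge i.+2; move: a3; rewrite b3 /lower.
set p := height _; set q := height _ => a3 p1 q1; exfalso.
(* The tooth point is a convex combination of heights that are at least -1, but the closing side is
   already below -1 here. *)
have k1 : 0 <= (x 0 0 - i.+1%:R) * (q + 1) by apply: mulr_ge0; lra.
have k2 : 0 <= (1 - (x 0 0 - i.+1%:R)) * (p + 1) by apply: mulr_ge0; lra.
have k3 : 0 <= (2 * H + 2) * (x 0 0 - 1) by apply: mulr_ge0; lra.
lra.
Qed.

Lemma zigzag_polygon : is_polygon zigzag.
Proof.
have h0 := H0; have n1 := N1.
split=> //.
- move=> i; apply/seteqP; split=> x; last first.
    by move=> ->; split; [exact: segr|exact: segl].
  move=> [/sideE h1 /sideE h2] /=; rewrite /zigzag; move: h2; rewrite ordSE.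
  case: eqP => [iE|/eqP ni] h2.
    rewrite iE in h1; have [[[h] _]|[_ _ ->//]] := meet (ltn0Sn N) (leqnn _) h2 h1.
    by move: N0; rewrite h.
  have iN : (i < N.+1)%N by rewrite ltn_neqAle ni -ltnS ltn_ord.
  have [[_ ->//]|[i0 /eqP]] := meet (ltnSn i) iN h1 h2.
  by rewrite i0 eqSS eq_sym => /eqP E; move: N0; rewrite E.
- have W (i j : 'I_N.+2) : (i < j)%N -> j != ordS i -> i != ordS j ->
      side zigzag i `&` side zigzag j = set0.
    move=> ij ji ij'; apply/seteqP; split=> x // [/sideE h1 /sideE h2].
    have jN : (j <= N.+1)%N by rewrite -ltnS.
    have [[jE _]|[i0 jN' _]] := meet ij jN h1 h2.
      move/negP: ji; apply; apply/eqP/val_inj; rewrite ordSE ifN//.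
      by apply: contraTneq ij => ->; rewrite -leqNgt -ltnS.
    by move/negP: ij'; apply; apply/eqP/val_inj; rewrite ordSE jN' eqxx.
  move=> i j; rewrite -(inj_eq val_inj) neq_ltn => /orP[|] ij h1 h2; first exact: W.
  by rewrite setIC; exact: W.
- move=> i; rewrite /collinear !mxE.
  rewrite /zigzag !ordSE /zvertex; have [iE|/eqP ni] := eqVneq (i : nat) N.+1.
    rewrite iE /= ltnn N0 !mk0 !mk1 /height /lower /=.
    move=> E; have : N%:R * (H + 1) = 0 :> R by lra.
    by move=> /eqP; rewrite mulf_eq0; apply/negP; rewrite negb_or !gt_eqF//; lra.
  have [iE|ni'] := eqVneq (i : nat) N.
    rewrite iE eqxx /= leqnn ltnn /= !mk0 !mk1 => E.
    have : (lower N%:R - height N) * N%:R = 0 by rewrite [height 0]/height /= in E; lra.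
    move=> /eqP; rewrite mulf_eq0; apply/negP; rewrite negb_or subr_eq0 lt_eqF//=.
    by rewrite gt_eqF//; lra.
  have iN : (i < N)%N.
    rewrite ltn_neqAle ni' -ltnS ltn_neqAle -ltnS ltn_ord andbT; exact/eqP.
  rewrite eqSS (negPf ni') (ltnW iN) iN /=.
  have [iN'|iN'] := ltnP i.+1 N.
    rewrite !mk0 !mk1 -!natr1 /height /=; case: (odd i) => /=; nra.
  have iE : N = i.+1 by apply/eqP; rewrite eqn_leq iN'.
  rewrite !mk0 !mk1 -iE => E; have lN := lowerN.
  have Nr : N%:R - i%:R = 1 :> R by apply/eqP; rewrite subr_eq nat1r; apply/eqP; congr _%:R.
  by rewrite Nr in E; lra.
Qed.

(** Vertical clearance under the spike with axis [j], which falls from H to -1 over a unit of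
    length. *)
Let tent (j : nat) x : R := H - (H + 1) * `|x 0 0 - j%:R| - x 0 1.

Definition zigzag_inner : set (pt R) := [set x |
  [/\ lower (x 0 0) < x 0 1, x 0 0 < N%:R &
      exists j : nat, [/\ ~~ odd j, (j <= N)%N &
        x 0 1 < H - (H + 1) * `|x 0 0 - j%:R|]]].

Let lip_tent j : lipschitz2 (tent j) (H + 1).
Proof.
have h0 := H0; move=> x y; rewrite /tent.
have E p q r : p - r - (q - r) = p - q :> R by ring.
have := lerB_dist (x 0 0 - j%:R) (y 0 0 - j%:R); rewrite E.
have := lerB_dist (y 0 0 - j%:R) (x 0 0 - j%:R); rewrite E [`|y 0 0 - x 0 0|]distrC.
have := ler_norm (x 0 1 - y 0 1); have := ler_norm (y 0 1 - x 0 1).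
rewrite [`|y 0 1 - x 0 1|]distrC ler_norml.
have := normr_ge0 (x 0 0 - y 0 0); have := normr_ge0 (x 0 1 - y 0 1).
set a := `|x 0 0 - y 0 0|; set b := `|x 0 1 - y 0 1|.
by move=> *; apply/andP; split; nra.
Qed.

Let lip_lower : lipschitz2 (fun x => x 0 1 - lower (x 0 0)) (2 * H + 2).
Proof.
have h0 := H0; move=> x y; rewrite /lower.
have p1 := ler_norm (x 0 1 - y 0 1); have p2 := ler_norm (y 0 1 - x 0 1).
have p3 := ler_norm (x 0 0 - y 0 0); have p4 := ler_norm (y 0 0 - x 0 0).
have p5 := normr_ge0 (x 0 1 - y 0 1).
move: p1 p2 p3 p4 p5; rewrite [`|y 0 0 - _|]distrC [`|y 0 1 - _|]distrC ler_norml.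
set a := `|x 0 0 - y 0 0|; set b := `|x 0 1 - y 0 1|.
by move=> *; apply/andP; split; nra.
Qed.

Let lip_right : lipschitz2 (fun x => N%:R - x 0 0) 1.
Proof.
move=> x y; rewrite mul1r.
have -> : N%:R - x 0 0 - (N%:R - y 0 0) = - (x 0 0 - y 0 0) by ring.
by rewrite normrN lerDl.
Qed.

Lemma zigzag_inner_itv x : zigzag_inner x ->
  [/\ 0 < x 0 0, x 0 0 < N%:R, lower N%:R < x 0 1 & x 0 1 < H].
Proof.
have h0 := H0; move=> [l1 l2 [j [_ _ hj]]].
have xH : x 0 1 < H by have := normr_ge0 (x 0 0 - j%:R); nra.
have x0 : 0 < x 0 0 by move: l1; rewrite /lower => l1; nra.
by split=> //; move: l1; rewrite /lower => l1; nra.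
Qed.

(** The even end of [i, i + 1] is the even integer nearest to [r], so only its spike matters above
    this interval. *)
Let dist_even (j i : nat) (r : R) : ~~ odd j -> i%:R <= r < i%:R + 1 ->
  `|r - (if odd i then i.+1 else i)%:R| <= `|r - j%:R|.
Proof.
move=> oj /andP[r1 r2]; set e := if _ then _ else _.
have [->//|je] := eqVneq j e.
have oe : ~~ odd e by rewrite /e; case: ifP => //= ->.
have [ij|ji] := leqP i j.
  have : (i.+2 <= j)%N.
    move: je oj; rewrite /e; case: ifP => oi; move=> je oj.
      rewrite ltn_neqAle eq_sym je ltn_neqAle ij andbT/=.
      by apply: contraNneq oj => <-.
    have ij' : (i < j)%N by rewrite ltn_neqAle eq_sym je.
    rewrite ltn_neqAle ij' andbT; apply: contraNneq oj => <- /=.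
    by rewrite oi.
  rewrite -(ler_nat R) -!natr1 => hj.
  rewrite [leRHS]distrC [leRHS]ger0_norm; last lra.
  by rewrite ler_norml /e; case: (odd i); rewrite -?natr1; apply/andP; split; lra.
have hj : j%:R + 1 <= i%:R :> R by rewrite natr1 ler_nat.
rewrite [leRHS]ger0_norm; last lra.
by rewrite ler_norml /e; case: (odd i); rewrite -?natr1; apply/andP; split; lra.
Qed.

Lemma inner_zigzag : inner zigzag zigzag_inner.
Proof.
have h0 := H0; have n1 := N1.
have K1 : 0 < H + 1 by lra.
have K2 : 0 < 2 * H + 2 by lra.
split.
- have -> : zigzag_inner = [set x : pt R | 0 < x 0 1 - lower (x 0 0)] `&` [set x : pt R | 0 < N%:R - x 0 0]
     `&` \bigcup_(j in [set j | ~~ odd j && (j <= N)%N]) [set x | 0 < tent j x].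
    apply/seteqP; split=> x /=.
      move=> [l1 l2 [j [oj jN hj]]]; split; first by rewrite !subr_gt0.
      by exists j => /=; rewrite ?oj// /tent subr_gt0.
    move=> [[l1 l2] [j /= /andP[oj jN]]]; rewrite /tent subr_gt0 => hj.
    by split; [lra|lra|exists j].
  apply: openI; last by apply: bigcup_open => j _; exact: (lip_open K1 (lip_tent j)).
  apply: openI; [exact: (lip_open K2 lip_lower)|exact: (lip_open ltr01 lip_right)].
- apply/boundedP; exists (N%:R + H + `|lower N%:R|) => x /zigzag_inner_itv[x0 x1 y0 y1].
  have := ler_norm (- lower N%:R); rewrite normrN => h1.
  have := normr_ge0 (lower N%:R) => h2.
  by rewrite !ler_norml; split; apply/andP; split; lra.
- move=> x cx.
  have l1 : 0 <= x 0 1 - lower (x 0 0).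
    by apply: (lip_closure K2 lip_lower _ cx) => y [? _ _] /=; lra.
  have l2 : 0 <= N%:R - x 0 0.
    by apply: (lip_closure ltr01 lip_right _ cx) => y [_ ? _] /=; lra.
  (* There are finitely many spikes: if all clearances were negative at [x], they would be so on a
     common box. *)
  have [j [oj jN hj]] : exists j : nat, [/\ ~~ odd j, (j <= N)%N & 0 <= tent j x].
    apply: contrapT => nj.
    have [|e e0 he] := @uniform_radius R N.+1 (fun j e => ~~ odd j ->
        forall y, box x e y -> tent j y < 0).
      move=> j; have [oj|oj] := boolP (odd j); first by exists 1.
      have tj : 0 < - tent j x.
        rewrite oppr_gt0 ltNge; apply/negP => hj; apply: nj; exists j; split=> //; exact: (ltn_ord j).
      have [e e0 he] := lip_box x K1 (lip_tent j) tj.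
      exists e => // e' /andP[_ ee] _ y /(box_le ee)/he; rewrite ltr_norml => /andP[_]; lra.
    have [y yb [_ _ [j [oj jN hj]]]] := (closure_boxP _ _).1 cx e e0.
    have := he e _ (Ordinal (jN : (j < N.+1)%N)) oj y yb.
    by rewrite e0 lexx /tent => /(_ isT) /=; lra.
  have xH : x 0 1 <= H by move: hj; rewrite /tent; have := normr_ge0 (x 0 0 - j%:R); nra.
  have [e1|/eqP n_1] := eqVneq (x 0 1) (lower (x 0 0)).
    right; exists (Ordinal (ltnSn N.+1)) => //; apply/sideE; rewrite /on_side /=.
    rewrite ltnNge leqnSn /= gtn_eqF//; split=> //; apply/andP; split; last lra.
    by move: xH; rewrite e1 /lower => xH; nra.
  have [e2|/eqP n_2] := eqVneq (x 0 0) N%:R.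
    right; exists (Ordinal (leqnSn N.+1)) => //; apply/sideE; rewrite /on_side /=.
    rewrite ltnn eqxx -e2; split=> //; apply/andP; split; first lra.
    rewrite /height; case: ifP => oN; last by [].
    have jN' : j%:R + 1 <= N%:R :> R.
      rewrite natr1 ler_nat ltn_neqAle jN andbT; apply: contraNneq oj => ->.
      by rewrite oN.
    by move: hj; rewrite /tent e2 ger0_norm; [nra|lra].
  have x0 : 0 < x 0 0 by move: n_1 l1 xH; rewrite /lower; nra.
  pose i := Num.truncn (x 0 0).
  have /andP[i1 i2] : i%:R <= x 0 0 < i.+1%:R by rewrite truncn_itv// ltW.
  have iN : (i < N)%N by rewrite -(ltr_nat R); lra.
  rewrite -natr1 in i2.
  pose j0 := if odd i then i.+1 else i.
  have oj0 : ~~ odd j0 by rewrite /j0; case: ifP => //= ->.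
  have j0N : (j0 <= N)%N by rewrite /j0; case: ifP => // _; exact: ltnW.
  have jj0 : `|x 0 0 - j0%:R| <= `|x 0 0 - j%:R|.
    by apply: dist_even => //; rewrite i1.
  (* The clearance under the nearest spike is at least that under [j], so it is positive or zero;
     zero places [x] on side [i]. *)
  have [hj0|hj0] := ltP 0 (tent j0 x).
    by left; split; [lra|lra|exists j0; split=> //; move: hj0; rewrite /tent; lra].
  right; exists (Ordinal (leqW (leqW iN))) => //; apply/sideE; rewrite /on_side /= iN.
  split; first by apply/andP; split; lra.
  have : tent j0 x = 0 by apply/eqP; rewrite eq_le hj0 /=; move: hj; rewrite /tent; nra.
  rewrite /tent /j0 /height /=; case: (odd i) => /=.
    by rewrite -natr1 ler0_norm; [lra|lra].
  by rewrite ger0_norm; [lra|lra].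
Qed.

Lemma zigzag_inner_off x : zigzag_inner x -> ~ curve zigzag x.
Proof.
have h0 := H0; have n1 := N1; move=> /[dup] /zigzag_inner_itv[x0 _ _ _].
move=> [l1 l2 [j [oj jN hj]]] [i _ /sideE]; rewrite /on_side.
case: ltnP => iN.
  move=> [/andP[i1 i2] xE]; set k : nat := i in iN i1 i2 xE.
  (* [dist_even] takes half-open intervals, so the right end of side [k] is treated as the left end
     of the next interval. *)
  have [xi|xi] := eqVneq (x 0 0) (k%:R + 1).
    have := @dist_even j k.+1 (x 0 0) oj; rewrite -natr1 -xi lexx ltrDl ltr01 => /(_ isT).
    move: xE; rewrite /height /=; case: (odd k) => /=; rewrite -?natr1 -?xi; last first.
      rewrite opprD addrA subrr sub0r normrN1; nra.
    rewrite subrr normr0; nra.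
  have := @dist_even j k (x 0 0) oj; rewrite i1 lt_neqAle xi i2 => /(_ isT).
  move: xE; rewrite /height /=; case: (odd k) => /=.
    rewrite -natr1 ler0_norm; [nra|lra].
  by rewrite ger0_norm; [nra|lra].
case: eqP => _ [a1 a2]; first by rewrite a1 ltxx in l2.
by rewrite a2 ltxx in l1.
Qed.

(** An odd abscissa is at distance at least 1 from every spike axis, where spikes have come down to
    -1; above that level they are separate. *)
Lemma zigzag_inner_odd x (p : nat) : zigzag_inner x -> -1 < x 0 1 -> odd p ->
  x 0 0 != p%:R.
Proof.
have h0 := H0; move=> [_ _ [j [oj _ hj]]] x1 op; apply/eqP => xp.
have : 1 <= `|p%:R - j%:R : R|.
  have [pj|jp] := ltnP p j.
    have : p%:R + 1 <= j%:R :> R by rewrite natr1 ler_nat.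
    by move=> h; rewrite ler0_norm; lra.
  have : j%:R + 1 <= p%:R :> R.
    by rewrite natr1 ler_nat ltn_neqAle jp andbT; apply: contraNneq oj => ->; rewrite op.
  by move=> h; rewrite ger0_norm; lra.
by move: hj; rewrite xp; nra.
Qed.

End Zigzag.

(** * The grid *)

Section Grid.
Variable R : realType.
Implicit Types (x y : pt R) (A : set (pt R)).

(** Spike 0 exists only to the right of its axis and a spike with axis [N] only to the left, so the
    sample point is 1/2 to the right of axis 0 and 1/2 to the left of any other axis 2a. *)
Definition grid (a : nat) : R := if a is 0%N then 1 / 2 else 2 * a%:R - 1 / 2.

Lemma grid_ge a : 1 / 2 <= grid a.
Proof. by case: a => [|a] //=; have : 0 <= a%:R :> R by []; rewrite -[a.+1%:R]natr1; lra. Qed.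

Lemma grid_lt a : grid a < (2 * a).+1%:R.
Proof. by rewrite -[_.+1%:R]natr1 natrM; case: a => [|a] /=; lra. Qed.

Lemma grid_gt a b : (a < b)%N -> (2 * a).+1%:R < grid b.
Proof.
case: b => // b; rewrite ltnS -(ler_nat R) /= -[b.+1%:R]natr1 -[(2 * a).+1%:R]natr1 natrM => ab; lra.
Qed.

Lemma grid_dist a : `|grid a - (2 * a)%:R| = 1 / 2.
Proof.
rewrite natrM; case: a => [|a] /=; first by rewrite mulr0 subr0 ger0_norm; lra.
by rewrite ler0_norm; lra.
Qed.

Lemma grid_bound N a : (0 < N)%N -> (a < N.+2./2)%N -> grid a < N%:R.
Proof.
move=> N0; have N1 : 1 <= N%:R :> R by rewrite ler1n.
case: a => [|a] /=; first by lra.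
rewrite ltnS geq_half_double -(ler_nat R) -mul2n natrM; lra.
Qed.

(** At distance 1/2 from its axis a spike has height H - (H + 1) / 2 = (H - 1) / 2, and the closing
    line is at most at -1 there. *)
Lemma grid_inner N (H y : R) a : (0 < N)%N -> 0 < H -> (a < N.+2./2)%N -> 0 < y ->
  y < (H - 1) / 2 -> zigzag_inner N H (mk (grid a) y).
Proof.
move=> N0 H0 aN y0 yH; split; rewrite ?mk0 ?mk1.
- by rewrite /lower; have := grid_ge a; nra.
- exact: grid_bound.
- exists (2 * a)%N; split; first by rewrite oddM.
    by move: aN; rewrite /= ltnS geq_half_double -mul2n.
  by rewrite grid_dist; lra.
Qed.

Lemma lip_coord (i : 'I_2) (p : R) : lipschitz2 (fun x : pt R => x 0 i - p) 1.
Proof.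
move=> x y; rewrite mul1r opprB addrA subrK.
by case: (ord2P i) => ->; rewrite ?lerDl ?lerDr.
Qed.

(** For a < b the odd number 2a + 1 separates the two grid values, and the coordinate would have to
    take it on [A]. *)
Lemma connected_grid (i : 'I_2) A x y a b : connected A ->
  (forall z p, A z -> odd p -> z 0 i != p%:R) -> A x -> A y ->
  x 0 i = grid a -> y 0 i = grid b -> a = b.
Proof.
move=> cA nA; wlog ab : a b x y / (a < b)%N.
  move=> h Ax Ay xa yb; have [ab|ba|//] := ltngtP a b; first exact: (h a b x y).
  by apply/esym/(h b a y x).
move=> Ax Ay xa yb; exfalso.
have := connected_sign ltr01 (lip_coord i (2 * a).+1%:R) cA _ Ay Ax.
rewrite xa yb !subr_gt0 grid_gt// => h; have := grid_lt a.
suff : (2 * a).+1%:R < grid a by lra.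
apply: h => // z Az /eqP; rewrite subr_eq0; apply/negP; apply: nA => //=.
by rewrite mul2n odd_double.
Qed.

Lemma ncomp_lower N M : (0 < N)%N -> (0 < M)%N ->
  exists (v : 'I_N.+2 -> pt R) (w : 'I_M.+2 -> pt R),
  [/\ is_polygon v, is_polygon w &
      ncomp_ge (region v `&` region w) (M.+2./2 * N.+2./2)].
Proof.
(* Now (H - 1) / 2 = M and (K - 1) / 2 = N, so at the sample points the spikes of each polygon reach
   beyond all grid values used by the other. *)
move=> N0 M0; pose H : R := 2 * M%:R + 1; pose K : R := 2 * N%:R + 1.
have H0 : 0 < H by rewrite /H ltr_wpDl ?mulr_ge0.
have K0 : 0 < K by rewrite /K ltr_wpDl ?mulr_ge0.
pose v := @zigzag R N H; pose w := @swap R \o @zigzag R M K.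
pose I := zigzag_inner N H; pose J := @swap R @^-1` zigzag_inner M K.
have iI : inner v I by exact: inner_zigzag.
have iJ : inner w J by apply: inner_swap; exact: inner_zigzag.
have Iv : I `<=` region v.
  by apply: inner_region iI _ => x; exact: zigzag_inner_off.
have Jw : J `<=` region w.
  by apply: inner_region iJ _ => x Jx /curve_swap; exact: zigzag_inner_off.
exists v, w; split; [exact: zigzag_polygon|by apply: polygon_swap; exact: zigzag_polygon|].
pose G := region v `&` region w.
pose T := ('I_(M.+2./2) * 'I_(N.+2./2))%type.
pose P (c : T) := mk (grid c.2) (grid c.1).
have IP c : I (P c).
  apply: grid_inner => //; first by have := grid_ge c.1; lra.
  by rewrite /H addrK mulrC mulKf ?pnatr_eq0//; exact: grid_bound.
have JP c : J (P c).
  have -> : J (P c) = zigzag_inner M K (mk (grid c.1) (grid c.2)).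
    by rewrite /J /= /swap /P mk0 mk1.
  apply: grid_inner => //; first by have := grid_ge c.2; lra.
  by rewrite /K addrK mulrC mulKf ?pnatr_eq0//; exact: grid_bound.
have GP c : G (P c) by split; [exact/Iv|exact/Jw].
have compI c : connected_component G (P c) `<=` I.
  apply: (inner_sub (x := P c) iI) => //; first exact: component_connected.
    by move=> z /connected_component_sub[[]].
  exact: connected_component_refl.
have compJ c : connected_component G (P c) `<=` J.
  apply: (inner_sub (x := P c) iJ) => //; first exact: component_connected.
    by move=> z /connected_component_sub[_ []].
  exact: connected_component_refl.
have inj c c' : connected_component G (P c) = connected_component G (P c') -> c = c'.
  move=> E; have cA := @component_connected _ G (P c).
  have A1 : connected_component G (P c) (P c) by exact: connected_component_refl.
  have A2 : connected_component G (P c) (P c').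
    by rewrite E; exact: connected_component_refl.
  (* Points of [I] have positive abscissa and points of [J] positive ordinate, so the component
     stays where the spikes of both polygons are separate. *)
  have pos z : connected_component G (P c) z -> -1 < z 0 0 /\ -1 < z 0 1.
    move=> Az; have [x0 _ _ _] := zigzag_inner_itv H0 (compI c z Az).
    have [] := zigzag_inner_itv K0 (compJ c z Az); rewrite /swap mk0; lra.
  have h1 : val c.1 = val c'.1.
    apply: (connected_grid (i := 1) cA _ A1 A2); rewrite ?mk1//.
    move=> z p Az op; have := zigzag_inner_odd K0 (compJ c z Az) _ op.
    by rewrite /swap mk0 mk1; apply; case: (pos z Az).
  have h2 : val c.2 = val c'.2.
    apply: (connected_grid (i := 0) cA _ A1 A2); rewrite ?mk0//.
    move=> z p Az op; apply: (zigzag_inner_odd H0 (compI c z Az) _ op).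
    by case: (pos z Az).
  by case: c c' h1 h2 {E cA A1 A2 pos} => [? ?] [? ?] /= /val_inj -> /val_inj ->.
have cT : #|{: T}| = (M.+2./2 * N.+2./2)%N by rewrite card_prod !card_ord.
rewrite -cT; exists (fun i => connected_component G (P (enum_val i))); split.
  by move=> i j /inj/enum_val_inj.
by move=> i; exists (P (enum_val i)); first exact: GP.
Qed.

End Grid.

Theorem theorem1 (R : realType) (n m : nat) :
  (3 <= m)%N -> (m <= n)%N ->
  ((((m./2 * n./2)%N)%:R : R)%:E <= fmax R n m)%E /\
  (fmax R n m <= ((m./2)%:R * n%:R / 2 + m%:R / 2 : R)%:E)%E.
Proof.
move=> m3 mn; split.
  apply: ereal_sup_ubound; exists (m./2 * n./2)%N => //=.
  case: m m3 mn => [|[|M]] // M0; case: n => [|[|N]] // MN.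
  exact: (ncomp_lower R (leq_trans M0 MN) M0).
apply: ge_ereal_sup => _ [c /= [v [w [pv pw /(ncomp_upper pv pw) ub]]] <-].
by move: ub; rewrite -(ler_nat R) natrD !natrM lee_fin; lra.
Qed.
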